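(* There is an absolute constant $d_0$ such that for every graph $H$ with $t$ vertices and average degree $d\geq d_0$, $$f(H)\leq 3.895\sqrt{\ln d}\,t.$$
   Context: All graphs are finite and simple. A graph $H$ is a minor of a graph $G$ if a graph isomorphic to $H$ can be obtained from a subgraph of $G$ by contracting edges. For a graph $H$, $f(H)$ denotes the infimum of all numbers $d$ such that every graph with average degree at least $d$ contains $H$ as a minor. *)

(* Defs.v *)
From HB Require Import structures.
From mathcomp Require Import all_boot all_order all_algebra.
From mathcomp Require Import all_classical all_reals.
From mathcomp Require Import ereal exp.
Set Implicit Arguments. Unset Strict Implicit. Unset Printing Implicit Defensive.
Import Order.TTheory GRing.Theory Num.Theory.

Definition simple_graph (V : finType) (g : rel V) : Prop :=
  symmetric g /\ irreflexive g.

(* Average degree: (sum of degrees) / |V| = 2|E|/|V| (0 for the empty graph). *)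
Definition avg_deg (R : realType) (V : finType) (g : rel V) : R :=
  ((\sum_(v : V) #|[set u | g v u]|)%N%:R / #|V|%:R)%R.

Definition connected_in (V : finType) (g : rel V) (B : {set V}) : Prop :=
  forall x y, x \in B -> y \in B ->
    connect [rel a b | [&& g a b, a \in B & b \in B]] x y.

Definition is_minor (W : finType) (h : rel W) (V : finType) (g : rel V) : Prop :=
  exists B : W -> {set V},
    [/\ forall x, (0 < #|B x|)%N,
        forall x, connected_in g (B x),
        forall x y, x != y -> [disjoint B x & B y] &
        forall x y, h x y -> exists u v, [/\ u \in B x, v \in B y & g u v]].

(* f(H) = inf { d | every graph with average degree >= d has H as a minor },
   as an extended real (+oo if the set is empty). *)
Definition fH (R : realType) (W : finType) (h : rel W) : \bar R :=
  ereal_inf [set (d%:E)%E | d in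
    [set d : R | forall (V : finType) (g : rel V),
       simple_graph g -> (d <= avg_deg R g)%R -> is_minor h g]].

(* Main.v *)
Require Import Defs.
From HB Require Import structures.
From mathcomp Require Import all_boot all_order all_algebra.
From mathcomp Require Import all_classical all_reals.
From mathcomp Require Import ereal exp.
From mathcomp Require Import sequences fingroup perm zify ring lra.
Import Order.TTheory GRing.Theory Num.Theory.
(* Imported again so that the names of finset prevail over classical_sets. *)
From mathcomp Require Import fintype finset.
Set Implicit Arguments. Unset Strict Implicit. Unset Printing Implicit Defensive.

(* Following Mader, one contracts edges lying in few triangles until a host
   graph of average degree at least P0 becomes a graph on m <= P vertices, with
   P >= P0, in which every degree is at least m/2 + 33P/400; in particular any
   two vertices have many common neighbours.  Set aside a small random reserve
   with the same property, arrange the remaining vertices in s layers and cut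
   them into random transversals.  If r bounds the proportion of non-neighbours
   of a vertex, a typical transversal misses only a fraction r^s of the
   vertices; discarding the few exceptional ones, two transversals have no edge
   between them with probability about r^(s^2).  Here s is a constant multiple
   of m/t, and 3.895 is large enough to make s^2 ln(1/r) exceed ln d by a
   constant factor whatever the ratio m/P.  Hence assigning the vertices of H to
   the transversals at random loses only O(t) of its edges, and the reserve is
   used to make the transversals connected and to restore the lost edges. *)

(** * Minors inside vertex sets *)

(** The relative notion keeps the vertex type fixed: deletions and contractions only shrink the set
    and change the relation, which suits induction on [#|A|]. *)
Definition minor_in (W : finType) (C : {set W}) (h : rel W)
    (V : finType) (A : {set V}) (g : rel V) : Prop :=
  exists B : W -> {set V},
    [/\ forall x, x \in C -> (0 < #|B x|)%N /\ B x \subset A,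
        forall x, x \in C -> connected_in g (B x),
        forall x y, x \in C -> y \in C -> x != y -> [disjoint B x & B y] &
        forall x y, x \in C -> y \in C -> h x y ->
          exists u v, [/\ u \in B x, v \in B y & g u v]].

Definition inside (V : finType) (g : rel V) (B : {set V}) : rel V :=
  [rel a b | [&& g a b, a \in B & b \in B]].

Lemma inside_sub (V : finType) (g : rel V) (B B' : {set V}) x y :
  B \subset B' -> connect (inside g B) x y -> connect (inside g B') x y.
Proof.
move=> sB; apply: connect_sub => u v /and3P[guv uB vB].
by apply: connect1; rewrite /inside /= guv !(subsetP sB).
Qed.

(** Branch sets compose by union. A path in the intermediate graph lifts by walking inside one
    branch set to the end of a crossing edge, following that edge, and repeating. *)
Lemma minor_in_trans (W V' V : finType) (C : {set W}) (h : rel W)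
    (A' : {set V'}) (g' : rel V') (A : {set V}) (g : rel V) :
  minor_in C h A' g' -> minor_in A' g' A g -> minor_in C h A g.
Proof.
case=> B [B1 B2 B3 B4] [B' [B'1 B'2 B'3 B'4]].
exists (fun w => \bigcup_(x in B w) B' x).
have BA w x : w \in C -> x \in B w -> x \in A'.
  by move=> wC; apply: (subsetP (proj2 (B1 w wC))).
split.
- move=> w wC; have [Bw sB] := B1 w wC; split.
    case/card_gt0P: Bw => x xB; have [/card_gt0P[u uB] _] := B'1 x (BA w x wC xB).
    by apply/card_gt0P; exists u; apply/bigcupP; exists x.
  by apply/bigcupsP => x xB; have [] := B'1 x (BA w x wC xB).
- move=> w wC u v /= /bigcupP[x xB ux] /bigcupP[y yB vy].
  have /connectP[p pth ey] := B2 w wC x y xB yB.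
  set S := \bigcup_(z in B w) B' z.
  have inn z a b : z \in B w -> a \in B' z -> b \in B' z -> connect (inside g S) a b.
    move=> zB az bz; apply: (inside_sub (B := B' z)); first exact: (bigcup_max z).
    exact: (B'2 z (BA w z wC zB)).
  elim: p x xB u ux pth ey => [|z p IH] x xB u ux /=.
    by move=> _ ey; subst y; apply: (inn x).
  case/andP=> /and3P[gxz _ zB] pth ey.
  have [a [b [ax bz gab]]] := B'4 x z (BA w x wC xB) (BA w z wC zB) gxz.
  apply: connect_trans (inn x u a xB ux ax) _.
  apply: connect_trans (IH z zB b bz pth ey).
  apply: connect1; rewrite /inside /= gab /S /=.
  by apply/andP; split; apply/bigcupP; [exists x|exists z].
- move=> w w' wC w'C ww'; apply/pred0P => u /=; apply/negbTE/negP.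
  case/andP=> /bigcupP[x xB ux] /bigcupP[y yB uy].
  have /pred0P/(_ x) /= := B3 w w' wC w'C ww'; rewrite xB /=.
  case: (eqVneq x y) => [->|xy]; first by rewrite yB.
  have /pred0P/(_ u) /= := B'3 x y (BA w x wC xB) (BA w' y w'C yB) xy.
  by rewrite ux uy.
- move=> w w' wC w'C hww'.
  have [x [y [xB yB gxy]]] := B4 w w' wC w'C hww'.
  have [a [b [ax bz gab]]] := B'4 x y (BA w x wC xB) (BA w' y w'C yB) gxy.
  by exists a, b; split=> //; apply/bigcupP; [exists x|exists y].
Qed.

Lemma minor_in_is_minor (W V : finType) (h : rel W) (g : rel V) :
  minor_in [set: W] h [set: V] g -> is_minor h g.
Proof.
case=> B [B1 B2 B3 B4]; exists B; split.
- by move=> x; have [] := B1 x (in_setT x).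
- by move=> x; apply: B2.
- by move=> x y; apply: B3.
- by move=> x y; apply: B4.
Qed.

Lemma connected_in1 (V : finType) (g : rel V) x : connected_in g [set x].
Proof. by move=> u v /set1P-> /set1P->. Qed.

Lemma minor_in_sub (V : finType) (A' A : {set V}) (g : rel V) :
  A' \subset A -> minor_in A' g A g.
Proof.
move=> sA; exists (fun x => [set x]); split.
- by move=> x xA; rewrite cards1 sub1set (subsetP sA).
- by move=> x _; apply: connected_in1.
- by move=> x y _ _ xy; rewrite disjoints1 inE.
- by move=> x y _ _ gxy; exists x, y; rewrite !set11.
Qed.

(** [y] is absorbed by [x] and is to be removed from the vertex set afterwards; [u != v] suppresses
    the loop that the edge [x y] would leave at [x]. *)
Definition contract_edge (V : finType) (g : rel V) (x y : V) : rel V :=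
  [rel u v | (u != v) && [|| g u v, (u == x) && g y v | (v == x) && g u y]].

Lemma contract_sym (V : finType) (g : rel V) x y :
  symmetric g -> symmetric (contract_edge g x y).
Proof.
move=> sg u v; rewrite /contract_edge /= eq_sym (sg u v) (sg y v) (sg u y).
by case: (_ != _) => //=; case: (g v u) => //=; rewrite orbC.
Qed.

Lemma contract_irr (V : finType) (g : rel V) x y : irreflexive (contract_edge g x y).
Proof. by move=> u; rewrite /contract_edge /= eqxx. Qed.

Lemma minor_in_contract (V : finType) (A : {set V}) (g : rel V) x y :
  symmetric g -> x \in A -> y \in A -> g x y ->
  minor_in (A :\ y) (contract_edge g x y) A g.
Proof.
move=> sg xA yA gxy.
exists (fun u => if u == x then [set x; y] else [set u]); split.
- move=> u /setD1P[uy uA]; case: eqP => _; last by rewrite cards1 sub1set.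
  by rewrite subUset !sub1set xA yA; split=> //; apply/card_gt0P; exists x; rewrite set21.
- move=> u _; case: eqP => _; last exact: connected_in1.
  have cxy : connect (inside g [set x; y]) x y.
    by apply: connect1; rewrite /inside /= gxy set21 set22.
  have cyx : connect (inside g [set x; y]) y x.
    by apply: connect1; rewrite /inside /= sg gxy set21 set22.
  by move=> a b /set2P[] -> /set2P[] ->; rewrite ?connect0.
- move=> u v /setD1P[uy uA] /setD1P[vy vA] uv.
  case: (eqVneq u x) => [ux|ux]; case: (eqVneq v x) => [vx|vx].
  + by rewrite ux vx eqxx in uv.
  + by rewrite disjoint_sym disjoints1 !inE negb_or vx vy.
  + by rewrite disjoints1 !inE negb_or ux uy.
  + by rewrite disjoints1 !inE.
- move=> u v _ _ /andP[uv /or3P[guv|/andP[/eqP-> gyv]|/andP[/eqP-> guy]]].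
  + by exists u, v; split=> //; case: eqP => [->|_]; rewrite ?set21 ?set11.
  + exists y, v; rewrite eqxx set22; split=> //.
    by case: eqP => [->|_]; rewrite ?set21 ?set11.
  + exists u, y; rewrite eqxx set22; split=> //.
    by case: eqP => [->|_]; rewrite ?set21 ?set11.
Qed.

Definition nb (V : finType) (g : rel V) (A : {set V}) (u : V) : {set V} :=
  [set v in A | g u v].

Definition deg_sum (V : finType) (g : rel V) (A : {set V}) : nat :=
  (\sum_(u in A) #|nb g A u|)%N.

(** Besides the edge [x y] itself, one edge disappears for each common neighbour of [x] and [y],
    since its two edges merge; degree sums count every edge twice. *)
Lemma deg_sum_contract (V : finType) (A : {set V}) (g : rel V) x y :
  symmetric g -> irreflexive g -> x \in A -> y \in A -> g x y ->
  (deg_sum g A <= deg_sum (contract_edge g x y) (A :\ y)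
     + 2 * #|nb g (nb g A x) y| + 2)%N.
Proof.
move=> sg ig xA yA gxy.
have yx : y != x by apply/eqP => yx; rewrite yx ig in gxy.
set g' := contract_edge g x y; set A' := A :\ y; set T := nb g (nb g A x) y.
have xA' : x \in A' by rewrite !inE eq_sym yx.
rewrite /deg_sum (bigD1 y) //= (bigD1 x) /=; last by rewrite xA eq_sym.
rewrite [X in (_ <= X + _ + _)%N](bigD1 x) //=.
rewrite [X in (_ + (_ + X) <= _)%N](eq_bigl (fun i => (i \in A') && (i != x))); last first.
  by move=> i; rewrite !inE; case: (i \in A) => //=; rewrite ?andbT ?andbF.
(* Only a common neighbour loses a unit of degree: for any other neighbour of [y] the edge to [y]
   becomes an edge to [x]. *)
have others : (\sum_(i in A' | i != x) #|nb g A i| <=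
    \sum_(i in A' | i != x) #|nb g' A' i| + #|T|)%N.
  have -> : #|T| = (\sum_(i in A' | i != x) (i \in T))%N.
    rewrite -sum1_card big_mkcond [RHS]big_mkcond /=; apply: eq_bigr => i _.
    rewrite !inE; case: (i =P x) => [->|_].
      by rewrite ig !andbF.
    case: (i =P y) => [->|_]; first by rewrite ig andbF.
    by case: (i \in A) => //=; case: (g x i); case: (g y i).
  rewrite -big_split /=; apply: leq_sum => i /andP[/setD1P[iy iA] ix].
  case giy: (g i y); last first.
    apply: leq_trans (leq_addr _ _); apply: subset_leq_card; apply/subsetP => v.
    rewrite !inE /g' /contract_edge /= => /andP[vA giv]; rewrite vA /= giv.
    have -> /= : v != y by apply: contraTneq giv => ->; rewrite giy.
    by rewrite andbT; apply: contraTneq giv => ->; rewrite ig.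
  have ySub : y \in nb g A i by rewrite !inE yA.
  rewrite (cardsD1 y) ySub.
  case gix: (g i x).
    have -> : (i \in T) = true by rewrite !inE iA sg gix sg giy.
    rewrite addnC leq_add2r; apply: subset_leq_card; apply/subsetP => v.
    rewrite !inE /g' /contract_edge /= => /and3P[vy vA giv]; rewrite vy vA giv /= andbT.
    by apply: contraTneq giv => ->; rewrite ig.
  apply: leq_trans (leq_addr _ _).
  rewrite (cardsD1 x (nb g' A' i)).
  have -> : x \in nb g' A' i by rewrite !inE /g' /contract_edge /= eq_sym yx xA /= ix eqxx sg giy !orbT.
  rewrite leq_add2l; apply: subset_leq_card; apply/subsetP => v.
  rewrite !inE /g' /contract_edge /= => /and3P[vy vA giv]; rewrite vy vA giv /= !andbT.
  apply/andP; split; first by apply: contraTneq giv => ->; rewrite gix.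
  by apply: contraTneq giv => ->; rewrite ig.
(* Inclusion-exclusion on the two neighbourhoods; their union lies in the new neighbourhood of [x]
   together with [x] and [y], whence the 2. *)
have atx : (#|nb g A y| + #|nb g A x| <= #|nb g' A' x| + #|T| + 2)%N.
  have -> : T = nb g A y :&: nb g A x.
    by apply/setP => v; rewrite !inE; case: (v \in A) => //=; rewrite andbC.
  rewrite -cardsUI addnAC leq_add2r.
  have -> : 2 = #|[set x; y]| by rewrite cards2 eq_sym yx.
  apply: leq_trans (leq_card_setU _ _); apply: subset_leq_card.
  apply/subsetP => v; rewrite !inE /g' /contract_edge /=.
  case: (v =P x) => [|/eqP vx]; first by rewrite orbT.
  case: (v =P y) => [|/eqP vy]; first by rewrite !orbT.
  rewrite !orbF /= eq_sym vx eqxx /=.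
  by case: (v \in A) => //=; rewrite orbC => /orP[->|->]; rewrite ?orbT.
rewrite mul2n -addnn; lia.
Qed.

Lemma deg_sum_del (V : finType) (A : {set V}) (g : rel V) x :
  symmetric g -> x \in A -> nb g A x = set0 -> deg_sum g (A :\ x) = deg_sum g A.
Proof.
move=> sg xA nx.
rewrite [RHS]/deg_sum (bigD1 x) //= nx cards0 add0n /deg_sum.
apply: eq_big => [i|i /setD1P[ix iA]]; first by rewrite !inE andbC.
apply: eq_card => v; rewrite !inE; case: (v =P x) => [->|_] //=.
have := nx; move/setP/(_ i); rewrite !inE iA /= sg => ->.
by rewrite andbF.
Qed.

(** * Dense minors *)

Lemma nb_sub (V : finType) (g : rel V) A u : nb g A u \subset A.
Proof. by apply/subsetP => v; rewrite inE => /andP[]. Qed.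

Lemma minor_in_refl (V : finType) (A : {set V}) (g : rel V) : minor_in A g A g.
Proof. exact: minor_in_sub. Qed.

(* The excess [deg_sum g A - P0 * n] is transferred to [P]; this bounds the
   neighbourhood of a vertex of minimum degree without deleting edges. *)
Lemma locally_dense_minor (P0 n : nat) (V : finType) (g : rel V) (A : {set V}) :
  symmetric g -> irreflexive g -> #|A| = n -> (0 < n)%N -> (0 < P0)%N ->
  (P0 * n <= deg_sum g A)%N ->
  exists P (A1 : {set V}) (g1 : rel V), [/\ (P0 <= P)%N, symmetric g1, irreflexive g1, minor_in A1 g1 A g &
    (0 < #|A1| <= P)%N /\ forall u, u \in A1 -> (P <= 2 * #|nb g1 A1 u| + 1)%N].
Proof.
elim: n g A => // n IH g A sg ig cA _ P00 hD.
have /card_gt0P[x0 x0A] : (0 < #|A|)%N by rewrite cA.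
have [x /= xA' xmin] := arg_minnP (fun u => #|nb g A u|) x0A.
have xA : x \in A by [].
have hx : (n.+1 * #|nb g A x| <= deg_sum g A)%N.
  by rewrite -cA -sum_nat_const; apply: leq_sum => u uA; apply: xmin.
have cAx y : y \in A -> #|A :\ y| = n.
  by move=> yA; have := cardsD1 y A; rewrite yA cA => -[].
have [nx|/set0Pn[y0 y0N]] := eqVneq (nb g A x) set0.
  have hdel := deg_sum_del sg xA nx.
  have n0 : (0 < n)%N.
    case: n {IH cA hx cAx} hD (cAx x xA) => // hD /eqP; rewrite cards_eq0 => /eqP Ax.
    by move: hD; rewrite -hdel /deg_sum Ax big_set0 muln1; case: P0 P00.
  have [|P [A1 [g1 [h1 h2 h3 h4 h5]]]] := IH g (A :\ x) sg ig (cAx x xA) n0 P00.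
    by rewrite hdel; apply: leq_trans hD; rewrite leq_mul2l leqnSn orbT.
  exists P, A1, g1; split=> //; apply: minor_in_trans h4 _.
  by apply: minor_in_sub; apply: subD1set.
(* By [hD] the subtraction is exact. The average degree, hence the degree of [x], is at most [P],
   and losing [P] from the degree sum still leaves [P0 * n]. *)
set P := (deg_sum g A - P0 * n.+1 + P0)%N.
have dxP : (#|nb g A x| <= P)%N.
  rewrite -(leq_pmul2l (ltn0Sn n)); apply: leq_trans hx _.
  rewrite /P; nia.
have [/existsP[y /andP[yN hy]]|] :=
  boolP [exists y, (y \in nb g A x) && (2 * #|nb g (nb g A x) y| + 1 < P)%N].
  have /andP[yA gxy] : (y \in A) && g x y by move: yN; rewrite inE.
  have hc := deg_sum_contract sg ig xA yA gxy.
  have n0 : (0 < n)%N.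
    rewrite -(cAx y yA); apply/card_gt0P; exists x; rewrite !inE xA andbT.
    by apply: contraTneq gxy => ->; rewrite ig.
  have [||P' [A1 [g1 [h1 h2 h3 h4 h5]]]] :=
    IH (contract_edge g x y) (A :\ y) (contract_sym x y sg) _ (cAx y yA) n0 P00.
  - exact: contract_irr.
  - rewrite /P in hy; nia.
  exists P', A1, g1; split=> //; apply: minor_in_trans h4 _.
  exact: minor_in_contract.
rewrite negb_exists => /forallP hN.
exists P, (nb g A x), g; split=> //.
- by rewrite /P leq_addl.
- exact: minor_in_sub (nb_sub g A x).
split; first by rewrite dxP andbT card_gt0; apply/set0Pn; exists y0.
by move=> u uN; have := hN u; rewrite uN /= -leqNgt.
Qed.

(* The invariant [n ^ 2 + P * n <= 4 * deg_sum g A + 2 * n] is impossible for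
   [3 * n < P + 2], so the contractions stop.  The edge to contract joins a
   vertex x of small degree to a vertex of small degree in the neighbourhood
   of x. *)
Lemma dense_minor_step (P n : nat) (V : finType) (g : rel V) (A : {set V}) :
  symmetric g -> irreflexive g -> #|A| = n -> (0 < n)%N -> (1100 <= P)%N ->
  (n ^ 2 + P * n <= 4 * deg_sum g A + 2 * n)%N ->
  exists (A1 : {set V}) (g1 : rel V), [/\ symmetric g1, irreflexive g1, minor_in A1 g1 A g,
    (0 < #|A1| <= n)%N & forall u, u \in A1 -> (200 * #|A1| + 33 * P <= 400 * #|nb g1 A1 u|)%N].
Proof.
elim: n g A => // n IH g A sg ig cA _ P0 hD.
have [/existsP[x /andP[xA hx]]|] :=
  boolP [exists x, (x \in A) && (400 * #|nb g A x| < 200 * n.+1 + 33 * P)%N]; last first.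
  rewrite negb_exists => /forallP hN.
  exists A, g; split=> //; first exact: minor_in_refl.
    by rewrite cA leqnn.
  by move=> u uA; have := hN u; rewrite uA /= -leqNgt cA.
have cAx y : y \in A -> #|A :\ y| = n.
  by move=> yA; have := cardsD1 y A; rewrite yA cA => -[].
have [nx|nx0] := eqVneq (nb g A x) set0.
  have hdel := deg_sum_del sg xA nx.
  have n0 : (0 < n)%N.
    case: n {IH cA hx cAx} hD (cAx x xA) => // hD /eqP; rewrite cards_eq0 => /eqP Ax.
    by move: hD; rewrite -hdel /deg_sum Ax big_set0; lia.
  have [|A1 [g1 [h1 h2 h3 /andP[h40 h4] h5]]] := IH g (A :\ x) sg ig (cAx x xA) n0 P0.
    by rewrite hdel; nia.
  exists A1, g1; split=> //; last by rewrite h40 (leq_trans h4).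
  by apply: minor_in_trans h3 _; apply: minor_in_sub; apply: subD1set.
set N := nb g A x.
have cN : (#|N| <= n.+1)%N by rewrite -cA subset_leq_card ?nb_sub.
have [/existsP[y /andP[yN hy]]|] :=
  boolP [exists y, (y \in N) && (400 * #|nb g N y| < 200 * #|N| + 33 * P)%N]; last first.
  rewrite negb_exists => /forallP hN.
  exists N, g; split=> //; first exact: minor_in_sub (nb_sub g A x).
    by rewrite cN card_gt0 nx0.
  by move=> u uN; have := hN u; rewrite uN /= -leqNgt.
have /andP[yA gxy] : (y \in A) && g x y by move: yN; rewrite inE.
have hc := deg_sum_contract sg ig xA yA gxy.
have n0 : (0 < n)%N.
  rewrite -(cAx y yA); apply/card_gt0P; exists x; rewrite !inE xA andbT.
  by apply: contraTneq gxy => ->; rewrite ig.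
have [||A1 [g1 [h1 h2 h3 /andP[h40 h4] h5]]] :=
    IH (contract_edge g x y) (A :\ y) (contract_sym x y sg) _ (cAx y yA) n0 P0.
- exact: contract_irr.
(* [hx] and [hy] bound four times the loss by [2 * n.+1 + 99 / 100 * P + 8], while the left side of
   the invariant drops by [2 * n.+1 + P - 3]; hence [1100 <= P]. *)
- by rewrite -/N in hx hc; nia.
exists A1, g1; split=> //; last by rewrite h40 (leq_trans h4).
by apply: minor_in_trans h3 _; apply: minor_in_contract.
Qed.

Lemma dense_minor (P0 : nat) (V : finType) (g : rel V) :
  symmetric g -> irreflexive g -> (0 < #|V|)%N -> (1100 <= P0)%N ->
  (P0 * #|V| <= deg_sum g [set: V])%N ->
  exists P (A : {set V}) (g1 : rel V),
    [/\ (P0 <= P)%N, symmetric g1, irreflexive g1, minor_in A g1 [set: V] g &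
     (0 < #|A| <= P)%N /\
     forall u, u \in A -> (200 * #|A| + 33 * P <= 400 * #|nb g1 A u|)%N].
Proof.
move=> sg ig V0 hP hD.
have [|P [A1 [g1 [hP0 s1 i1 m1 [/andP[c0 cP] d1]]]]] :=
  @locally_dense_minor P0 _ V g [set: V] sg ig (cardsT V) V0 _ hD.
  exact: leq_trans hP.
(* Since [#|A1| ^ 2 <= P * #|A1|], this degree bound is enough to start the second stage with its
   invariant. *)
have dP : ((P - 1) * #|A1| <= 2 * deg_sum g1 A1)%N.
  rewrite /deg_sum big_distrr /= mulnC -sum_nat_const.
  by apply: leq_sum => u uA; have := d1 u uA; lia.
have [||A2 [g2 [s2 i2 m2 /andP[c20 c2] d2]]] :=
  @dense_minor_step P _ V g1 A1 s1 i1 erefl c0 _ _.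
- exact: leq_trans hP0.
- nia.
exists P, A2, g2; split=> //; first exact: minor_in_trans m2 m1.
by rewrite c20 (leq_trans c2).
Qed.

(** * A reserve of common neighbours *)

(* Chernoff's bound with base 1/2: a colouring has weight 2 to the number of
   vertices of [C] outside the class [j], hence at least 2 ^ (#|C| - h) if
   that class is small in [C]. *)
Lemma count_few_in_class (b h : nat) (V : finType) (C : {set V}) (j : 'I_b) :
  (#|[set f : {ffun V -> 'I_b} | #|[set v in C | f v == j]| < h]| * (2 * b) ^ #|C|
    <= 2 ^ h * (2 * b - 1) ^ #|C| * b ^ #|V|)%N.
Proof.
pose w (v : V) (k : 'I_b) := (if v \in C then (if k == j then 1 else 2) else 1)%N.
have wE (f : {ffun V -> 'I_b}) : (2 ^ #|C| = (\prod_v w v (f v)) * 2 ^ #|[set v in C | f v == j]|)%N.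
  rewrite -sum1_card -[#|[set _ in _ | _]|]sum1_card !expn_sum.
  rewrite big_mkcond [X in (_ = _ * X)%N]big_mkcond -big_split /=.
  apply: eq_bigr => v _; rewrite /w inE; case: (v \in C) => //=.
  by case: (f v == j).
have hsum : (\sum_(f : {ffun V -> 'I_b}) \prod_v w v (f v) * b ^ #|C| = (2 * b - 1) ^ #|C| * b ^ #|V|)%N.
  rewrite -big_distrl /= -(bigA_distr_bigA w) /=.
  have sC v : (\sum_k w v k = if v \in C then 2 * b - 1 else b)%N.
    rewrite /w; case: (v \in C); last by rewrite sum1_card card_ord.
    rewrite (bigD1 j) //= eqxx (eq_bigr (fun=> 2%N)); last by move=> k /negbTE->.
    by rewrite sum_nat_const cardC1 card_ord; have := ltn_ord j; lia.
  rewrite -[#|C|]sum1_card -[#|V|]sum1_card !expn_sum.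
  rewrite (big_mkcond (mem C)) [X in (_ = X * _)%N]big_mkcond -!big_split /=.
  by apply: eq_bigr => v _; rewrite sC; case: (v \in C) => //; rewrite mulnC.
have hbad : (#|[set f : {ffun V -> 'I_b} | #|[set v in C | f v == j]| < h]| * 2 ^ #|C|
    <= \sum_(f : {ffun V -> 'I_b}) 2 ^ h * \prod_v w v (f v))%N.
  rewrite -sum_nat_const [leqRHS](bigID (mem [set f : {ffun V -> 'I_b} | #|[set v in C | f v == j]| < h]%N)) /=.
  apply: leq_trans (leq_addr _ _); apply: leq_sum => f; rewrite inE => hf.
  by rewrite (wE f) mulnC leq_mul2r leq_exp2l // ltnW // orbT.
rewrite expnMn mulnA; apply: leq_trans (leq_mul hbad (leqnn _)) _.
by rewrite -big_distrr /= -!mulnA -hsum big_distrl.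
Qed.

(** Colour the vertices with [b] colours at random. A union bound over sets and colours makes every
    class meet every [C i] in at least [h] vertices, so one may take a class holding at most the
    average share of [A]. *)
Lemma exists_reserve (b h n0 : nat) (V I : finType) (A : {set V}) (C : I -> {set V}) :
  (0 < b)%N -> (forall i, C i \subset A) -> (forall i, (n0 <= #|C i|)%N) ->
  (#|I| * b * 2 ^ h * (2 * b - 1) ^ n0 < (2 * b) ^ n0)%N ->
  exists R0 : {set V}, [/\ R0 \subset A, (b * #|R0| <= #|A|)%N &
    forall i, (h <= #|R0 :&: C i|)%N].
Proof.
move=> b0 CA Cn hlt.
pose bad (i : I) (j : 'I_b) :=
  [set f : {ffun V -> 'I_b} | #|[set v in C i | f v == j]| < h]%N.
have hbad i j : (#|bad i j| * (2 * b) ^ n0 <= 2 ^ h * (2 * b - 1) ^ n0 * b ^ #|V|)%N.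
  have h1 := count_few_in_class h (C i) j.
  have b2 : (0 < 2 * b)%N by lia.
  have e2 k : ((2 * b - 1) ^ k <= (2 * b) ^ k)%N by case: k => // k; rewrite leq_exp2r //; lia.
  rewrite -(leq_pmul2r (_ : 0 < (2 * b) ^ (#|C i| - n0))%N) ?expn_gt0 ?b2 //.
  rewrite -mulnA -expnD subnKC // (leq_trans h1) //.
  rewrite -{1}(subnKC (Cn i)) expnD -!mulnA leq_mul2l leq_mul2l; apply/orP; right; apply/orP; right.
  by rewrite mulnC leq_mul2l e2 orbT.
have [f hf] : exists f : {ffun V -> 'I_b}, forall i j, f \notin bad i j.
  have [/existsP[f /forallP hf]|] :=
    boolP [exists f : {ffun V -> 'I_b}, [forall i, [forall j, f \notin bad i j]]].
    by exists f => i j; apply: (forallP (hf i)).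
  rewrite negb_exists => /forallP hN.
  have : (b ^ #|V| <= \sum_i \sum_j #|bad i j|)%N.
    have -> : (b ^ #|V| = \sum_(f : {ffun V -> 'I_b}) 1)%N.
      by rewrite sum1_card card_ffun card_ord.
    under [leqRHS]eq_bigr => i _ do under eq_bigr => j _ do rewrite -sum1_card big_mkcond /=.
    under [leqRHS]eq_bigr do rewrite exchange_big /=.
    rewrite exchange_big /=; apply: leq_sum => f _.
    have := hN f; rewrite negb_forall => /existsP[i]; rewrite negb_forall => /existsP[j].
    rewrite negbK => fb; rewrite (bigD1 i) //= (bigD1 j) //= fb.
    by rewrite -addnA leq_addr.
  rewrite -(leq_pmul2r (_ : 0 < (2 * b) ^ n0)%N); last by rewrite expn_gt0; lia.
  move=> hle; exfalso.
  have : ((\sum_i \sum_j #|bad i j|) * (2 * b) ^ n0 <= #|I| * (b * (2 ^ h * (2 * b - 1) ^ n0 * b ^ #|V|)))%N.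
    rewrite big_distrl /= -sum_nat_const; apply: leq_sum => i _.
    rewrite big_distrl /= -[X in (_ <= X * _)%N](card_ord b) -sum_nat_const.
    by apply: leq_sum => j _; apply: hbad.
  move=> h2; have := leq_trans hle h2; rewrite leqNgt => /negP; apply.
  have bV : (0 < b ^ #|V|)%N by rewrite expn_gt0 b0.
  by rewrite !mulnA [ltnRHS]mulnC ltn_pmul2r.
pose Rj j := [set v in A | f v == j].
have [j hj] : exists j, (b * #|Rj j| <= #|A|)%N.
  have [/existsP[j hj]|] := boolP [exists j, (b * #|Rj j| <= #|A|)%N]; first by exists j.
  rewrite negb_exists => /forallP hN.
  have : (\sum_(j < b) (#|A| + 1) <= \sum_(j < b) b * #|Rj j|)%N.
    by apply: leq_sum => j _; rewrite addn1 ltnNge hN.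
  rewrite sum_nat_const card_ord -big_distrr /= leq_pmul2l //.
  have -> : (\sum_j #|Rj j| = #|A|)%N.
    rewrite -[RHS]sum1_card (partition_big f predT) //=; apply: eq_bigr => j _.
    by rewrite -sum1_card; apply: eq_bigl => v; rewrite inE.
  by rewrite addn1 ltnn.
exists (Rj j); split=> //; first by apply/subsetP => v; rewrite inE => /andP[].
move=> i; have := hf i j; rewrite inE -leqNgt => h1; apply: leq_trans h1 _.
apply: subset_leq_card; apply/subsetP => v; rewrite !inE => /andP[vC ->].
by rewrite vC (subsetP (CA i) v vC).
Qed.

(** * Random blocks *)

Section Averaging.
Local Open Scope ring_scope.
Variable R : realFieldType.

Lemma exists_le_average (I : finType) (f : I -> R) (c : R) :
  (0 < #|I|)%N -> \sum_(i : I) f i <= #|I|%:R * c -> exists i, f i <= c.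
Proof.
move=> I0 hs; have [/existsP[i hi]|] := boolP [exists i, f i <= c]; first by exists i.
rewrite negb_exists => /forallP hN.
have : \sum_(i : I) c < \sum_(i : I) f i.
  apply: ltr_sum => [|i _]; last by rewrite ltNge hN.
  by case/card_gt0P: I0 => i _; apply/hasP; exists i; rewrite ?mem_index_enum.
by rewrite sumr_const -mulr_natl ltNge hs.
Qed.

(** Composition with a permutation carrying [(a, b)] to [(a', b')] shows that the count is the same
    for all pairs of distinct values, and each permutation is counted by exactly one pair. *)
Lemma count_perm2 (T : finType) (x y a b : T) : x != y -> a != b ->
  (#|T| * #|T|.-1 * \sum_(s : {perm T}) ((s x == a) && (s y == b)) = (#|T|)`!)%N.
Proof.
move=> xy ab.
pose c a b := (\sum_(s : {perm T}) ((s x == a) && (s y == b)))%N.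
have cE a' b' : a' != b' -> c a' b' = c a b.
  move=> ab'; pose u := tperm a a'; pose t := (u * tperm (u b) b')%g.
  have ta : t a = a'.
    have ua : u a = a' by rewrite tpermL.
    have ub : u b != a'.
      by apply: contraNneq ab => e; apply/eqP/(@perm_inj _ u); rewrite ua e.
    by rewrite permM ua tpermD // eq_sym.
  have tb : t b = b' by rewrite permM tpermL.
  rewrite /c (reindex_inj (mulIg t)) /=; apply: eq_bigr => s _.
  have tE z : (s * t)%g z = t (s z) by rewrite permM.
  by rewrite !tE -ta -tb !(inj_eq (@perm_inj _ t)).
transitivity (\sum_(a' : T) \sum_(b' | b' != a') c a' b')%N.
  rewrite (eq_bigr (fun=> (#|T|.-1 * c a b)%N)).
    by rewrite sum_nat_const mulnA.
  move=> a' _; rewrite (eq_bigr (fun=> c a b)); first by rewrite sum_nat_const cardC1.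
  by move=> b' h; apply: cE; rewrite eq_sym.
have -> : (#|T|)`! = (\sum_(s : {perm T}) 1)%N.
  rewrite sum1_card -cardsT -card_perm; apply: eq_card => s.
  by rewrite [LHS]unfold_in; apply/subsetP => z _; rewrite inE.
rewrite /c.
under eq_bigr do rewrite exchange_big /=.
rewrite exchange_big /=; apply: eq_bigr => s _.
rewrite (bigD1 (s x)) //= [X in (_ + X)%N]big1 ?addn0.
  rewrite (bigD1 (s y)) /=; last by rewrite (inj_eq perm_inj) eq_sym.
  rewrite !eqxx big1 // => b' /andP[_ h].
  by rewrite [_ == b']eq_sym (negbTE h) andbF.
move=> a' h; rewrite big1 // => b' _.
by rewrite [_ == a']eq_sym (negbTE h).
Qed.

(** With an independent uniform permutation in each coordinate, the images of [x] and [y] form a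
    uniform pair of functions that differ everywhere; the factors clear denominators. *)
Lemma sum_perm_seq (I T : finType) (x y : T) (f : {ffun I -> T} -> {ffun I -> T} -> R) :
  x != y ->
  (#|T| * #|T|.-1)%:R ^+ #|I| *
    \sum_(s : {ffun I -> {perm T}}) f [ffun i => s i x] [ffun i => s i y] =
  ((#|T|)`!)%:R ^+ #|I| *
    \sum_(a : {ffun I -> T}) \sum_(b : {ffun I -> T} | [forall i, b i != a i]) f a b.
Proof.
move=> xy.
pose c (a b : T) : R := \sum_(s : {perm T}) ((s x == a) && (s y == b))%:R.
have cE a b : (#|T| * #|T|.-1)%:R * c a b = (b != a)%:R * ((#|T|)`!)%:R.
  case: (eqVneq b a) => [->|ba]; last first.
    by rewrite mul1r /c -natr_sum -natrM count_perm2 // eq_sym.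
  rewrite /c big1 ?mulr0 ?mul0r // => s _.
  case: eqP => //= <-; case: eqP => // /perm_inj yx.
  by rewrite yx eqxx in xy.
have -> : \sum_(s : {ffun I -> {perm T}}) f [ffun i => s i x] [ffun i => s i y] =
    \sum_(a : {ffun I -> T}) \sum_(b : {ffun I -> T}) f a b * \prod_i c (a i) (b i).
  transitivity (\sum_(s : {ffun I -> {perm T}}) \sum_(a : {ffun I -> T})
      \sum_(b : {ffun I -> T})
      f a b * \prod_i ((s i x == a i) && (s i y == b i))%:R).
    apply: eq_bigr => s _.
    rewrite (bigD1 [ffun i => s i x]) //= [X in _ + X]big1 ?addr0; last first.
      move=> a ha; rewrite big1 // => b _.
      have /existsP[i hi] : [exists i, s i x != a i].
        rewrite -negb_forall; apply: contra ha => /forallP h.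
        by apply/eqP/ffunP => i; rewrite ffunE (eqP (h i)).
      by rewrite (bigD1 i) //= (negbTE hi) mul0r mulr0.
    rewrite (bigD1 [ffun i => s i y]) //= [X in _ + X]big1 ?addr0; last first.
      move=> b hb.
      have /existsP[i hi] : [exists i, s i y != b i].
        rewrite -negb_forall; apply: contra hb => /forallP h.
        by apply/eqP/ffunP => i; rewrite ffunE (eqP (h i)).
      by rewrite (bigD1 i) //= (negbTE hi) andbF mul0r mulr0.
    by rewrite big1 ?mulr1 // => i _; rewrite !ffunE !eqxx.
  rewrite exchange_big /=; apply: eq_bigr => a _.
  rewrite exchange_big /=; apply: eq_bigr => b _.
  by rewrite -big_distrr /= /c bigA_distr_bigA.
rewrite !big_distrr /=; apply: eq_bigr => a _.
rewrite !big_distrr /= [RHS]big_mkcond /=; apply: eq_bigr => b _.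
rewrite mulrCA -!(prodr_const I) -big_split /=.
under eq_bigr do rewrite cE.
case: ifP => [/forallP h|/negbT].
  by rewrite mulrC; congr (_ * _); apply: eq_bigr => i _; rewrite h mul1r.
rewrite negb_forall => /existsP[i hi].
by rewrite (bigD1 i) //= (negbTE hi) !mul0r mulr0.
Qed.

Lemma prod_le_mean (s : nat) (E : 'I_s -> R) (Q : R) :
  (0 < s)%N -> (forall i, 0 <= E i) -> \sum_i E i <= Q ->
  \prod_i E i <= (Q / s%:R) ^+ s.
Proof.
move=> s0 E0 hQ.
have [h _] := leif_AGM (A := 'I_s) (E := E) (fun i _ => E0 i).
rewrite card_ord in h.
apply: le_trans h _; apply: lerXn2r.
- by rewrite nnegrE divr_ge0 // sumr_ge0.
- by rewrite nnegrE divr_ge0 // (le_trans _ hQ) // sumr_ge0.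
- by rewrite ler_wpM2r // invr_ge0.
Qed.

(** A function [a] encodes the transversal with vertices [(i, a i)], one in each of the [s] layers;
    [na] will be non-adjacency in the host graph. *)
Definition missed (s M : nat) (na : rel ('I_s * 'I_M)) (a : {ffun 'I_s -> 'I_M}) :
  {set 'I_s * 'I_M} := [set p | [forall i, na (i, a i) p]].

Definition fails (s M : nat) (na : rel ('I_s * 'I_M)) (a b : {ffun 'I_s -> 'I_M}) : bool :=
  [forall j, (j, b j) \in missed na a].

Lemma natr_forall (I : finType) (P : pred I) :
  ([forall i, P i] : nat)%:R = \prod_(i : I) (P i)%:R :> R.
Proof.
case: (boolP [forall i, P i]) => [/forallP h|].
  by rewrite big1 // => i _; rewrite h.
rewrite negb_forall => /existsP[i hi].
by rewrite (bigD1 i) //= (negbTE hi) mul0r.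
Qed.

Lemma natr_card (I : finType) (A : {set I}) : #|A|%:R = \sum_i (i \in A)%:R :> R.
Proof. by rewrite -sum1_card natr_sum big_mkcond; apply: eq_bigr => i _; case: ifP. Qed.

(** Exchange the sums: a transversal missing [p] is chosen layer by layer among the non-neighbours
    of [p], and AM-GM bounds the product of the [s] layer counts, whose sum is at most [Q]. *)
Lemma sum_missed (s M : nat) (na : rel ('I_s * 'I_M)) (Q : R) : (0 < s)%N ->
  (forall p, #|[set p' | na p' p]|%:R <= Q) ->
  \sum_(a : {ffun 'I_s -> 'I_M}) #|missed na a|%:R <= (s * M)%:R * (Q / s%:R) ^+ s.
Proof.
move=> s0 hQ.
under eq_bigr do rewrite natr_card.
rewrite exchange_big /=.
have -> : (s * M)%:R * (Q / s%:R) ^+ s = \sum_(p : 'I_s * 'I_M) (Q / s%:R) ^+ s.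
  by rewrite sumr_const card_prod !card_ord mulr_natl.
apply: ler_sum => p _.
under eq_bigr do rewrite inE natr_forall.
rewrite -(bigA_distr_bigA (fun i j => (na (i, j) p)%:R)) /=.
apply: prod_le_mean => // [i|]; first by apply: sumr_ge0.
apply: le_trans (hQ p); rewrite natr_card.
by rewrite pair_big /=; apply: ler_sum => -[i j] _; rewrite inE.
Qed.

Lemma sum_fails (s M : nat) (na : rel ('I_s * 'I_M)) (a : {ffun 'I_s -> 'I_M}) :
  (0 < s)%N ->
  \sum_(b : {ffun 'I_s -> 'I_M}) (fails na a b)%:R <= (#|missed na a|%:R / s%:R) ^+ s :> R.
Proof.
move=> s0.
under eq_bigr do rewrite natr_forall.
rewrite -(bigA_distr_bigA (fun i j => ((i, j) \in missed na a)%:R)) /=.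
apply: prod_le_mean => // [i|]; first by apply: sumr_ge0.
by rewrite natr_card pair_big /=; apply: ler_sum => -[i j] _.
Qed.

(* Block [a x] takes one vertex of each layer.  Sets with too many missed
   vertices are bad; in [f] bad blocks and failing pairs are weighted so that
   both have average at most 1. *)
Lemma exists_good_blocks (s M : nat) (na : rel ('I_s * 'I_M)) (Q B : R) :
  (0 < s)%N -> (1 < M)%N -> 0 < Q -> 0 < B ->
  (forall p, #|[set p' | na p' p]|%:R <= Q) ->
  exists (a : 'I_M -> {ffun 'I_s -> 'I_M}) (T : {set 'I_M}),
    [/\ forall x y i, x != y -> a x i != a y i,
        #|~: T|%:R <= 2 * M%:R / B &
        \sum_(x in T) \sum_(y | y != x) (fails na (a x) (a y))%:R
          <= 2 * M%:R ^+ 2 * (2 * B * (Q / (s * M)%:R) ^+ s) ^+ s].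
Proof.
move=> s0 M1 Q0 B0 hQ.
have sp : 0 < s%:R :> R by rewrite ltr0n.
have Mp : 0 < M%:R :> R by rewrite ltr0n ltnW.
have M1p : 0 < M.-1%:R :> R by rewrite ltr0n; lia.
(* [r] bounds the density of non-neighbours, and [pi] the probability that a good transversal fails
   with one differing from it everywhere: [B] comes from the threshold [th], 2 from
   [M <= 2 * M.-1]. *)
set r := Q / (s * M)%:R; set pi := (2 * B * r ^+ s) ^+ s.
have r0 : 0 < r by rewrite divr_gt0 // ltr0n muln_gt0 s0 ltnW.
have pi0 : 0 < pi by rewrite exprn_gt0 // !mulr_gt0 // exprn_gt0.
(* [B] times the bound for the average number of missed vertices, so that by Markov at most a
   proportion [1 / B] of the transversals is bad. *)
pose th : R := B * r ^+ s * (s * M)%:R.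
have th0 : 0 < th by rewrite !mulr_gt0 // ?exprn_gt0 // ltr0n muln_gt0 s0 ltnW.
pose bad (a : {ffun 'I_s -> 'I_M}) : bool := th < #|missed na a|%:R.
have QsE : (Q / s%:R) ^+ s = r ^+ s * M%:R ^+ s.
  rewrite -exprMn /r natrM; congr (_ ^+ _); field; rewrite ?lt0r_neq0 //.
have hbad : \sum_(a : {ffun 'I_s -> 'I_M}) (bad a)%:R <= M%:R ^+ s / B.
  rewrite ler_pdivlMr // -(ler_pM2r (_ : 0 < r ^+ s * (s * M)%:R)); last first.
    by rewrite mulr_gt0 ?exprn_gt0 // ltr0n muln_gt0 s0 ltnW.
  have -> : M%:R ^+ s * (r ^+ s * (s * M)%:R) = (s * M)%:R * (Q / s%:R) ^+ s.
    by rewrite QsE; ring.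
  apply: le_trans (sum_missed s0 hQ).
  rewrite -mulrA [B * _]mulrA -/th mulr_suml.
  apply: ler_sum => a _; rewrite /bad; case: (boolP (th < _)) => [/ltW h|_]; rewrite ?mul1r ?mul0r //.
have hgood a : ~~ bad a ->
    \sum_(b : {ffun 'I_s -> 'I_M}) (fails na a b)%:R <= (B * r ^+ s * M%:R) ^+ s.
  rewrite /bad -leNgt => h; apply: le_trans (sum_fails na a s0) _.
  apply: lerXn2r; rewrite ?nnegrE.
  - by rewrite divr_ge0 // ltW.
  - by rewrite !mulr_ge0 // ?exprn_ge0 // ltW.
  - by rewrite ler_pdivrMr //; apply: le_trans h _; rewrite /th natrM; lra.
pose f (a b : {ffun 'I_s -> 'I_M}) : R :=
  B * (bad a)%:R + pi^-1 * (~~ bad a && fails na a b)%:R.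
have hcount (a : {ffun 'I_s -> 'I_M}) :
    \sum_(b : {ffun 'I_s -> 'I_M} | [forall i, b i != a i]) 1 = M.-1%:R ^+ s :> R.
  rewrite big_mkcond /=.
  rewrite (eq_bigr (fun b : {ffun 'I_s -> 'I_M} => ([forall i, b i != a i] : nat)%:R));
    last by move=> b _; case: ifP.
  under eq_bigr do rewrite natr_forall.
  rewrite -(bigA_distr_bigA (fun i j => (j != a i)%:R)) /=.
  rewrite (eq_bigr (fun=> M.-1%:R)); first by rewrite prodr_const card_ord.
  move=> i _; rewrite -natr_sum; congr (_%:R).
  rewrite -[in RHS](card_ord M) -(cardC1 (a i)) -sum1_card [RHS]big_mkcond /=.
  by apply: eq_bigr => j _; rewrite inE; case: eqP.
have hf : \sum_(a : {ffun 'I_s -> 'I_M})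
    \sum_(b : {ffun 'I_s -> 'I_M} | [forall i, b i != a i]) f a b
    <= 2 * (M * M.-1)%:R ^+ s.
  have -> : 2 * (M * M.-1)%:R ^+ s =
     (M%:R ^+ s / B) * (B * M.-1%:R ^+ s) + M%:R ^+ s * M.-1%:R ^+ s :> R.
    by rewrite natrM exprMn; field; rewrite lt0r_neq0.
  rewrite /f; under eq_bigr do rewrite big_split /=.
  rewrite big_split /=; apply: lerD.
    apply: le_trans (ler_wpM2r _ hbad); last by rewrite mulr_ge0 ?exprn_ge0 // ltW.
    rewrite mulr_suml; apply: ler_sum => a _.
    rewrite -(hcount a) big_distrr /= big_distrr /=.
    by apply: ler_sum => b _; rewrite mulr1 mulrC.
  have -> : M%:R ^+ s * M.-1%:R ^+ s =
     \sum_(a : {ffun 'I_s -> 'I_M}) M.-1%:R ^+ s :> R.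
    by rewrite sumr_const card_ffun !card_ord -[RHS]mulr_natl natrX.
  apply: ler_sum => a _; rewrite -big_distrr /= ler_pdivrMl //.
  have [ba|ba] := boolP (bad a).
    by rewrite big1 //; apply: mulr_ge0; [exact: ltW|apply: exprn_ge0; exact: ltW].
  rewrite /=; apply: le_trans (_ : _ <= \sum_b (fails na a b)%:R) _.
    by rewrite big_mkcond /=; apply: ler_sum => b _; case: ifP.
  apply: le_trans (hgood a ba) _; rewrite /pi -exprMn; apply: lerXn2r; rewrite ?nnegrE.
  - by rewrite !mulr_ge0 // ?exprn_ge0 // ltW.
  - by rewrite !mulr_ge0 // ?exprn_ge0 // ltW.
  - have : M%:R <= 2 * M.-1%:R :> R by rewrite -natrM ler_nat; move: M1; clear; lia.
    have : 0 < B * r ^+ s by rewrite mulr_gt0 // exprn_gt0.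
    nra.
(* Permuting the layers independently cuts the grid into [M] disjoint transversals, any two of which
   form a uniform pair differing in every layer. *)
pose A (sg : {ffun 'I_s -> {perm 'I_M}}) x : {ffun 'I_s -> 'I_M} := [ffun i => sg i x].
have cardperm : #|{ffun 'I_s -> {perm 'I_M}}|%:R = (M`!)%:R ^+ s :> R.
  rewrite card_ffun card_ord -natrX; congr ((_ ^ _)%N%:R).
  by rewrite -[RHS]card_Sn; apply: eq_card => u; rewrite !inE.
have [||sg hsg] := @exists_le_average {ffun 'I_s -> {perm 'I_M}}
    (fun sg => \sum_x \sum_(y | y != x) f (A sg x) (A sg y)) (2 * (M * M.-1)%:R).
- by apply/card_gt0P; exists [ffun=> 1%g].
- rewrite exchange_big /=.
  under eq_bigr do rewrite exchange_big /=.
  have -> : #|{ffun 'I_s -> {perm 'I_M}}|%:R * (2 * (M * M.-1)%:R) =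
    \sum_(x : 'I_M) \sum_(y | y != x) (2 * (M`!)%:R ^+ s) :> R.
    rewrite (eq_bigr (fun=> M.-1%:R * (2 * (M`!)%:R ^+ s))).
      by rewrite sumr_const card_ord -[RHS]mulr_natl cardperm natrM; ring.
    by move=> x _; rewrite sumr_const cardC1 card_ord -[LHS]mulr_natl.
  apply: ler_sum => x _; apply: ler_sum => y yx.
  have M2 : 0 < (M * M.-1)%:R ^+ s :> R by rewrite exprn_gt0 // natrM mulr_gt0.
  rewrite -(ler_pM2l M2).
  have := @sum_perm_seq 'I_s 'I_M x y f; rewrite !card_ord eq_sym => /(_ yx) ->.
  apply: le_trans (ler_wpM2l _ hf) _; first by rewrite exprn_ge0.
  by rewrite le_eqVlt; apply/orP; left; apply/eqP; ring.
exists (A sg), [set x | ~~ bad (A sg x)].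
(* A bad [x] is charged with all its [M.-1] partners. Both terms are nonnegative, so the bound on
   their sum holds for each. *)
have split_f : \sum_x \sum_(y | y != x) f (A sg x) (A sg y) =
    B * M.-1%:R * #|~: [set x | ~~ bad (A sg x)]|%:R +
    pi^-1 * \sum_(x in [set x | ~~ bad (A sg x)])
              \sum_(y | y != x) (fails na (A sg x) (A sg y))%:R.
  rewrite /f; under eq_bigr do rewrite big_split /=.
  rewrite big_split /=; congr (_ + _).
    rewrite natr_card big_distrr /=; apply: eq_bigr => x _.
    rewrite sumr_const cardC1 card_ord !inE negbK -[LHS]mulr_natl; ring.
  rewrite big_distrr /= [RHS]big_mkcond /=; apply: eq_bigr => x _.
  rewrite inE -big_distrr /=; case: (bad _) => //=.
  by rewrite big1 ?mulr0.
set S2 := \sum_(x in _) _ in split_f *.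
set T := [set x | _] in S2 split_f *.
have S20 : 0 <= S2 by apply: sumr_ge0 => x _; apply: sumr_ge0.
rewrite split_f in hsg.
have T0 : 0 <= #|~: T|%:R :> R by [].
have p1 : 0 <= pi^-1 * S2 by rewrite mulr_ge0 // invr_ge0 ltW.
have p2 : 0 <= B * M.-1%:R * #|~: T|%:R by rewrite !mulr_ge0 // ltW.
rewrite natrM in hsg.
split.
- by move=> x y i xy; rewrite !ffunE (inj_eq perm_inj).
- rewrite ler_pdivlMr // -(ler_pM2r M1p); lra.
- have : pi^-1 * S2 <= 2 * (M%:R * M.-1%:R) by lra.
  rewrite ler_pdivrMl // => h; apply: le_trans h _.
  by rewrite [leRHS]mulrC ler_pM2l // ler_pM2l // expr2 ler_pM2l // ler_nat leq_pred.
Qed.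

(** * Random placement of [H] on the blocks *)

Lemma exists_inj_into (X Y : finType) (T : {set Y}) : (#|X| <= #|T|)%N ->
  exists f : X -> Y, injective f /\ forall x, f x \in T.
Proof.
move=> XT; exists (fun x => enum_val (widen_ord XT (enum_rank x))); split.
  move=> x x' /enum_val_inj /(congr1 (@nat_of_ord _)) /= /ord_inj.
  exact: enum_rank_inj.
by move=> x; apply: enum_valP.
Qed.

(** Fix an injection into [T] and precede it by a random permutation of [W]: each ordered edge of
    [h] then falls on a uniform ordered pair of distinct places. *)
Lemma exists_good_assignment (W X : finType) (h : rel W) (T : {set X})
    (F : X -> X -> R) (S D : R) :
  irreflexive h -> (1 < #|W|)%N -> (#|W| <= #|T|)%N ->
  (forall x y, 0 <= F x y) ->
  \sum_(x in T) \sum_(y | y != x) F x y <= S ->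
  \sum_(u : W) \sum_(v | h u v) 1 = D ->
  exists th : W -> X, [/\ injective th, forall w, th w \in T &
    (#|W| * #|W|.-1)%:R * \sum_u \sum_(v | h u v) F (th u) (th v) <= D * S].
Proof.
move=> ih W1 WT F0 hS hD.
have [th0 [th0I th0T]] := exists_inj_into WT.
pose c : R := (#|W| * #|W|.-1)%:R.
pose G u v := F (th0 u) (th0 v).
have hG : \sum_u \sum_(v | v != u) G u v <= S.
  apply: le_trans hS.
  have -> : \sum_u \sum_(v | v != u) G u v =
     \sum_(x in th0 @: [set: W]) \sum_(y in th0 @: [set: W] | y != x) F x y.
    rewrite big_imset /=; last by move=> ? ? _ _; apply: th0I.
    apply: eq_big => [u|u _]; first by rewrite inE.
    rewrite big_imset_cond /=; last by move=> ? ? _ _; apply: th0I.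
    by apply: eq_bigl => v; rewrite inE (inj_eq th0I).
  rewrite [leLHS]big_mkcond [leRHS]big_mkcond /=; apply: ler_sum => x _.
  case: ifP => [/imsetP[w _ ->]|_]; last by case: ifP => // _; apply: sumr_ge0.
  rewrite th0T [leLHS]big_mkcond [leRHS]big_mkcond /=; apply: ler_sum => y _.
  by case: ifP => [/andP[_ ->]|_] //; case: ifP.
pose A (s : {perm W}) := \sum_u \sum_(v | h u v) G (s u) (s v).
have key u v : u != v -> c * \sum_(s : {perm W}) G (s u) (s v) =
    ((#|W|)`!)%:R * \sum_a \sum_(b | b != a) G a b.
  move=> uv.
  have -> : \sum_(s : {perm W}) G (s u) (s v) =
     \sum_(a : W) \sum_(b | b != a) G a b * (\sum_(s : {perm W}) ((s u == a) && (s v == b)))%N%:R.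
    under [RHS]eq_bigr => a _ do under eq_bigr => b _ do rewrite natr_sum big_distrr /=.
    under [RHS]eq_bigr do rewrite exchange_big /=.
    rewrite [RHS]exchange_big /=; apply: eq_bigr => s _.
    rewrite (bigD1 (s u)) //= [X in _ + X]big1 ?addr0; last first.
      move=> a ha; rewrite big1 // => b _.
      by rewrite [_ == a]eq_sym (negbTE ha) mulr0.
    rewrite (bigD1 (s v)) /=; last by rewrite (inj_eq perm_inj) eq_sym.
    rewrite !eqxx mulr1 big1 ?addr0 // => b /andP[_ hb].
    by rewrite [_ == b]eq_sym (negbTE hb) andbF mulr0.
  rewrite !big_distrr /=; apply: eq_bigr => a _.
  rewrite !big_distrr /=; apply: eq_bigr => b ba.
  rewrite mulrCA /c -natrM count_perm2 //; last by rewrite eq_sym.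
  by rewrite mulrC.
have cp : #|{perm W}|%:R = ((#|W|)`!)%:R :> R.
  congr (_%:R); rewrite -[in RHS]cardsT -card_perm; apply: eq_card => s.
  by rewrite [RHS]unfold_in; apply/esym/subsetP => z _; rewrite inE.
have [||s hs] := @exists_le_average {perm W} (fun s => c * A s) (D * S).
- by apply/card_gt0P; exists 1%g.
- rewrite -big_distrr /= /A exchange_big /=.
  under eq_bigr do rewrite exchange_big /=.
  rewrite cp big_distrr /= -hD mulrCA mulr_suml; apply: ler_sum => u _.
  rewrite big_distrr /= mulr_suml; apply: ler_sum => v huv.
  rewrite mul1r key; last by apply: contraTneq huv => ->; rewrite ih.
  by rewrite ler_wpM2l.
exists (fun w => th0 (s w)); split=> // u v /th0I; exact: perm_inj.
Qed.

End Averaging.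

Local Open Scope ring_scope.

(** * Linking the blocks *)

Lemma connected_in_root (V : finType) (g : rel V) (B : {set V}) r : symmetric g ->
  (forall v, v \in B -> connect (inside g B) r v) -> connected_in g B.
Proof.
move=> sg hr u v uB vB; apply: connect_trans (hr v vB).
have sI : symmetric (inside g B).
  by move=> a b; rewrite /inside /= sg [(b \in B) && _]andbC.
by rewrite -/(inside g B) (sym_connect_sym sI); apply: hr.
Qed.

(* In each of [c] rounds one vertex of [Q] replaces all its neighbours in [S],
   at least a fraction 1/q of [S]; what remains is joined to a root by paths of
   length two. *)
Lemma connect_through (R : realFieldType) (V : finType) (g : rel V) (A Q : {set V})
    (k q c : nat) (S : {set V}) :
  symmetric g -> (0 < k)%N -> (0 < q)%N -> Q \subset A -> (#|Q| <= q * k)%N ->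
  (forall u v, u \in A -> v \in A -> (k <= #|Q :&: (nb g A u :&: nb g A v)|)%N) ->
  S \subset A -> (0 < #|S|)%N ->
  exists T : {set V}, [/\ T \subset Q, connected_in g (S :|: T) &
    (#|T|%:R <= 2 * c%:R + #|S|%:R * (1 - q%:R^-1) ^+ c :> R)%R].
Proof.
move=> sg k0 q0 QA Qk hk.
elim: c S => [|c IH] S SA S0.
  case/card_gt0P: (S0) => r rS; have rA := subsetP SA r rS.
  have ex v : exists w, (v \in S) ==> [&& w \in Q, g r w & g w v].
    have [vS|_] := boolP (v \in S); last by exists r.
    have /card_gt0P[w] := leq_trans k0 (hk r v rA (subsetP SA v vS)).
    by rewrite !inE => /and3P[wQ /andP[_ g1] /andP[_ g2]]; exists w; rewrite wQ g1 sg g2.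
  have [w hw] := fin_all_exists ex.
  exists (w @: S); split.
  - apply/subsetP => z /imsetP[v vS ->]; have := hw v; rewrite vS /=.
    by case/and3P.
  - apply: (connected_in_root (r := r)) => // v.
    have toS u : u \in S -> connect (inside g (S :|: w @: S)) r (w u) /\
        connect (inside g (S :|: w @: S)) (w u) u.
      move=> uS; have := hw u; rewrite uS /= => /and3P[_ g1 g2].
      have wI : w u \in w @: S by apply: imset_f.
      by split; apply: connect1; rewrite /inside /= ?g1 ?g2 !inE wI ?rS ?uS ?orbT.
    rewrite inE => /orP[vS|/imsetP[u uS ->]]; last by have [] := toS u uS.
    by have [h1 h2] := toS v vS; apply: connect_trans h1 h2.
  - by rewrite mulr0 add0r expr0 mulr1 ler_nat leq_imset_card.
(* Double counting: each vertex of [S] has at least [k] neighbours in [Q] and [#|Q| <= q * k], so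
   some [w] in [Q] is adjacent to at least a fraction [1 / q] of [S]. *)
have sumE : (\sum_(w in Q) #|[set u in S | g u w]| = \sum_(u in S) #|Q :&: nb g A u|)%N.
  under eq_bigr do rewrite -sum1_card big_mkcond /=.
  rewrite exchange_big /= [RHS]big_mkcond /=; apply: eq_bigr => u _.
  rewrite -sum1_card; case: (boolP (u \in S)) => uS; last first.
    by rewrite big1 // => w _; rewrite inE (negbTE uS).
  rewrite [RHS]big_mkcond [LHS]big_mkcond /=; apply: eq_bigr => w _.
  by rewrite !inE uS /=; case: (boolP (w \in Q)) => //= wQ; rewrite (subsetP QA w wQ).
have [w wQ hw] : exists2 w, w \in Q & (#|S| <= q * #|[set u in S | g u w]|)%N.
  have [/existsP[w /andP[wQ hw]]|] :=
    boolP [exists w, (w \in Q) && (#|S| <= q * #|[set u in S | g u w]|)%N]; first by exists w.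
  rewrite negb_exists => /forallP hN; exfalso.
  have h1 : (k * #|S| <= \sum_(w in Q) #|[set u in S | g u w]|)%N.
    rewrite sumE mulnC -sum_nat_const; apply: leq_sum => u uS.
    by have uA := subsetP SA u uS; have := hk u u uA uA; rewrite setIid.
  have h2 : (q * \sum_(w in Q) #|[set u in S | g u w]| + #|Q| <= #|Q| * #|S|)%N.
    rewrite big_distrr /= -sum_nat_const -[X in (_ + X)%N]sum1_card -big_split /=.
    by apply: leq_sum => w wQ; have := hN w; rewrite wQ /= -ltnNge addn1.
  have Q0 : (0 < #|Q|)%N.
    case/card_gt0P: (S0) => r rS; have rA := subsetP SA r rS.
    by apply: leq_trans k0 (leq_trans (hk r r rA rA) _); apply: subset_leq_card; apply: subsetIl.
  nia.
set N := [set u in S | g u w] in hw.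
set S' := w |: (S :\: N).
have S'A : S' \subset A.
  rewrite subUset sub1set (subsetP QA w wQ) /=.
  by apply: subset_trans SA; apply: subsetDl.
have S'0 : (0 < #|S'|)%N by apply/card_gt0P; exists w; rewrite setU11.
have [T [TQ Tc Tn]] := IH S' S'A S'0.
have NS : N \subset S by apply/subsetP => u; rewrite inE => /andP[].
exists (w |: T); split.
- by rewrite subUset sub1set wQ.
- have sub : S' :|: T \subset S :|: (w |: T).
    apply/subsetP => z; rewrite !inE.
    by case/orP => [/orP[->|/andP[_ ->]]|->]; rewrite ?orbT.
  apply: (connected_in_root (r := w)) => // v vB.
  have [vS'|vS'] := boolP (v \in S' :|: T).
    by apply: (inside_sub sub); apply: Tc => //; rewrite !inE eqxx.
  have vN : v \in N.
    by move: vB vS'; rewrite !inE; do ![case: (_ \in _) => //=]; case: eqP => //=; case: (g v w).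
  apply: connect1; rewrite /inside /= vB andbT !inE eqxx /= orbT andbT sg.
  by move: vN; rewrite inE => /andP[].
- have cT : #|w |: T|%:R <= 1 + #|T|%:R :> R.
    rewrite -[1]/(1%:R) -natrD ler_nat cardsU1; lia.
  have cS : #|S'|%:R <= 1 + #|S|%:R * (1 - q%:R^-1) :> R.
    have h1 : (#|S'| <= 1 + (#|S| - #|N|))%N.
      rewrite cardsU1 cardsD (setIidPr NS); lia.
    have h2 : (#|N| <= #|S|)%N by apply: subset_leq_card.
    have h3 : #|S'|%:R <= 1 + (#|S|%:R - #|N|%:R) :> R.
      by rewrite -natrB // -[1]/(1%:R) -natrD ler_nat; lia.
    apply: le_trans h3 _; rewrite lerD2l mulrBr mulr1 lerD2l lerN2.
    rewrite ler_pdivrMr ?ltr0n // -natrM ler_nat mulnC //.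
  have q1 : 0 <= 1 - q%:R^-1 :> R by rewrite subr_ge0 invf_le1 ?ltr0n // ler1n.
  have q2 : (1 - q%:R^-1) ^+ c <= 1 :> R.
    by rewrite exprn_ile1 // gerBl invr_ge0.
  (* [w] counts once in the new set and at most once more through [S'], as later factors do not
     exceed 1; this is the growth of [2 * c] by 2. *)
  apply: le_trans cT _; rewrite exprS mulrA.
  have := ler_wpM2r (exprn_ge0 c q1) cS.
  rewrite mulrDl mul1r -natr1 mulrDr; lra.
Qed.

Lemma disjoint_setU (V : finType) (A B C : {set V}) :
  [disjoint A :|: B & C] = [disjoint A & C] && [disjoint B & C].
Proof. by rewrite -!setI_eq0 finset.setIUl finset.setU_eq0. Qed.

Lemma connected_inU1 (V : finType) (g : rel V) (B : {set V}) u z : symmetric g ->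
  connected_in g B -> u \in B -> g u z -> connected_in g (z |: B).
Proof.
move=> sg cB uB guz; apply: (connected_in_root (r := u)) => // v.
rewrite in_setU1 => /orP[/eqP->|vB].
  by apply: connect1; rewrite /inside /= guz !inE uB eqxx orbT.
by apply: (inside_sub (B := B)); [apply: subsetUr|apply: cB].
Qed.

(** Greedy use of the reserve: first each block is made connected, then each pair in [E] gets a
    common neighbour. The last hypothesis keeps the used part within [k], so of the [2 * k] common
    neighbours of any two vertices at least [k] remain. *)
Lemma minor_of_linked_blocks (R : realFieldType) (W V : finType) (h : rel W) (g : rel V)
    (A R0 : {set V}) (S : W -> {set V}) (E : {set W * W}) (s k q c : nat) :
  symmetric g -> (0 < k)%N -> (0 < q)%N -> (0 < s)%N ->
  R0 \subset A -> (#|R0| <= q * k)%N ->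
  (forall u v, u \in A -> v \in A -> (2 * k <= #|R0 :&: (nb g A u :&: nb g A v)|)%N) ->
  (forall w, [/\ S w \subset A, [disjoint S w & R0] & #|S w| = s]) ->
  (forall x y, x != y -> [disjoint S x & S y]) ->
  (forall x y, h x y -> (x, y) \notin E ->
     exists u v, [/\ u \in S x, v \in S y & g u v]) ->
  #|W|%:R * (2 * c%:R + s%:R * (1 - q%:R^-1) ^+ c) + #|E|%:R <= k%:R :> R ->
  minor_in [set: W] h A g.
Proof.
move=> sg k0 q0 s0 RA Rq hR hS dS hE.
set b : R := 2 * c%:R + _ => hk.
pose used (T : W -> {set V}) := \bigcup_w T w.
pose ok (T : W -> {set V}) (n : R) := [/\ forall w, T w \subset R0,
  forall x y, x != y -> [disjoint T x & T y] & #|used T|%:R <= n].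
have SA w : S w \subset A by case: (hS w).
have q1 : 0 <= 1 - q%:R^-1 :> R by rewrite subr_ge0 invf_le1 ?ltr0n // ler1n.
have b0 : 0 <= b by rewrite addr_ge0 ?mulr_ge0 ?exprn_ge0.
have Tused (T : W -> {set V}) w : T w \subset used T by apply: (bigcup_max w).
have free T n u v : ok T n -> n <= k%:R -> u \in A -> v \in A ->
    (k <= #|(R0 :\: used T) :&: (nb g A u :&: nb g A v)|)%N.
  case=> _ _ hu hn uA vA; have := hR u v uA vA.
  have : (#|used T| <= k)%N by rewrite -(ler_nat R) (le_trans hu).
  have -> : (R0 :\: used T) :&: (nb g A u :&: nb g A v) =
     (R0 :&: (nb g A u :&: nb g A v)) :\: used T by rewrite finset.setIDAC.
  rewrite cardsD; have := subset_leq_card (finset.subsetIr (R0 :&: (nb g A u :&: nb g A v)) (used T)).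
  lia.
have upd T n w (X : {set V}) m : ok T n -> X \subset R0 :\: used T -> #|X|%:R <= m ->
    ok (fun x => if x == w then X :|: T x else T x) (n + m).
  case=> T1 T2 T3 XR Xm; move: XR; rewrite subsetD => /andP[XR XT]; split.
  - by move=> x; case: ifP => // _; rewrite subUset XR T1.
  - have dX y : [disjoint X & T y] by apply: disjointWr (Tused T y) XT.
    move=> x y xy; case: eqP => [xw|_]; case: eqP => [yw|_]; try by apply: T2.
    + by rewrite xw yw eqxx in xy.
    + by rewrite disjoint_setU dX T2.
    + by rewrite disjoint_sym disjoint_setU dX T2 // eq_sym.
  - apply: le_trans (lerD T3 Xm); rewrite -natrD ler_nat.
    apply: leq_trans (_ : #|used T :|: X| <= _)%N; last by rewrite cardsU leq_subr.
    apply: subset_leq_card; apply/bigcupsP => x _; case: ifP => _.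
      by rewrite subUset subsetUr (subset_trans (Tused T x)) ?subsetUl.
    by rewrite (subset_trans (Tused T x)) ?subsetUl.
have linkW (l : seq W) : (size l <= #|W|)%N ->
    exists T, [/\ ok T ((size l)%:R * b), forall w, w \notin l -> T w = set0 &
      forall w, w \in l -> connected_in g (S w :|: T w)].
  elim: l => [|w l IH] hl.
    exists (fun=> set0); split=> //; split.
    - by move=> w; rewrite sub0set.
    - by move=> x y _; rewrite disjoints_subset sub0set.
    - by rewrite mul0r /used big1_eq cards0.
  have [T [okT T0 Tc]] := IH (ltnW hl).
  have nb1 : (size l)%:R * b + b = (size (w :: l))%:R * b by rewrite /= -natr1 mulrDl mul1r.
  have hle : (size l)%:R * b <= k%:R.
    apply: le_trans hk; rewrite -[leLHS]addr0 lerD // ler_wpM2r // ler_nat.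
    exact: ltnW.
  have [wl|wl] := boolP (w \in l).
    exists T; split.
    - case: okT => T1 T2 T3; split=> //; apply: le_trans T3 _.
      by rewrite -nb1 lerDl.
    - by move=> x; rewrite inE negb_or => /andP[_ /T0].
    - by move=> x; rewrite inE => /orP[/eqP->|]; apply: Tc.
  have [X [XQ Xc Xn]] := @connect_through R V g A (R0 :\: used T) k q c (S w) sg k0 q0
    (subset_trans (subsetDl _ _) RA)
    (leq_trans (subset_leq_card (subsetDl _ _)) Rq)
    (fun u v uA vA => free T _ u v okT hle uA vA) (SA w)
    (ltac:(by case: (hS w) => _ _ ->)).
  exists (fun x => if x == w then X :|: T x else T x); split.
  - rewrite -nb1; apply: upd => //; apply: le_trans Xn _.
    by case: (hS w) => _ _ ->.
  - move=> x; rewrite inE negb_or => /andP[/negbTE-> /T0->] //.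
  - move=> x; rewrite inE; case: eqP => [->|_] /=; last exact: Tc.
    by rewrite T0 // setU0.
have [T [okT _ Tc]] := linkW (enum W) (ltac:(by rewrite cardE)).
have linkE (l : seq (W * W)) : (size l <= #|E|)%N ->
    exists T, [/\ ok T (#|W|%:R * b + (size l)%:R),
      forall w, connected_in g (S w :|: T w) &
      forall x y, (x, y) \in l ->
        exists u v, [/\ u \in S x :|: T x, v \in S y :|: T y & g u v]].
  elim: l => [|[x y] l IH] hl.
    exists T; split=> //; last by move=> w; apply: Tc; rewrite mem_enum.
    by rewrite addr0; move: okT; rewrite -cardE.
  have [T' [okT' Tc' Te']] := IH (ltnW hl).
  have hle : #|W|%:R * b + (size l)%:R <= k%:R.
    by apply: le_trans hk; rewrite lerD2l ler_nat ltnW.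
  have Sx z : exists u, u \in S z.
    by apply/card_gt0P; case: (hS z) => _ _ ->.
  have [u ux] := Sx x; have [v vy] := Sx y.
  have /card_gt0P[z] := leq_trans k0 (free T' _ u v okT' hle (subsetP (SA x) u ux) (subsetP (SA y) v vy)).
  rewrite inE => /andP[zQ]; rewrite !inE => /andP[/andP[_ guz] /andP[_ gvz]].
  (* [z] is adjacent to both [u] and [v]; adding it to the block of [x] keeps that block connected
     and realizes the edge to the block of [y]. *)
  exists (fun w => if w == x then [set z] :|: T' w else T' w); split.
  - rewrite /= -natr1 addrA; apply: upd => //; first by rewrite sub1set.
    by rewrite cards1.
  - move=> w; case: eqP => [->|_]; last exact: Tc'.
    rewrite finset.setUCA; apply: (connected_inU1 (u := u)) => //.
    by rewrite inE ux.
  - have mono w a : a \in S w :|: T' w ->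
        a \in S w :|: (if w == x then [set z] :|: T' w else T' w).
      by case: ifP => // _; rewrite !inE => /orP[->|->]; rewrite ?orbT.
    move=> x' y'; rewrite inE => /orP[/eqP[-> ->]|hl'].
      exists z, v; rewrite eqxx; split.
      + by rewrite !inE eqxx orbT.
      + by apply: mono; rewrite inE vy.
      + by rewrite sg.
    have [u' [v' [h1 h2 h3]]] := Te' x' y' hl'.
    by exists u', v'; split=> //; apply: mono.
have [T' [[T1 T2 _] Tc' Te']] := linkE (enum E) (ltac:(by rewrite -cardE)).
exists (fun w => S w :|: T' w); split.
- move=> w _; have [h1 h2 h3] := hS w; split.
    by apply: leq_trans (subset_leq_card (subsetUl _ _)); rewrite h3.
  by rewrite subUset h1 (subset_trans (T1 w)).
- by move=> w _.
- move=> x y _ _ xy.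
  have dd w w' : [disjoint S w & T' w'].
    by case: (hS w) => _ h2 _; apply: disjointWr (T1 w') h2.
  rewrite disjoint_setU [X in X && _]disjoint_sym [X in _ && X]disjoint_sym.
  by rewrite !disjoint_setU dS 1?eq_sym // dd T2 1?eq_sym // disjoint_sym dd.
- move=> x y _ _ hxy; have [xyE|xyE] := boolP ((x, y) \in E).
    by apply: Te'; rewrite mem_enum.
  have [u [v [h1 h2 h3]]] := hE x y hxy xyE.
  by exists u, v; rewrite !inE h1 h2.
Qed.

(** * The minor in a dense graph, with free parameters *)

Lemma deg_sumE (R : realFieldType) (W : finType) (h : rel W) :
  \sum_(u : W) \sum_(v | h u v) 1 = (deg_sum h [set: W])%:R :> R.
Proof.
rewrite /deg_sum natr_sum [RHS]big_mkcond; apply: eq_bigr => u _.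
rewrite in_setT -sum1_card natr_sum; apply: eq_bigl => v.
by rewrite !inE.
Qed.

Lemma common_nb_card (V : finType) (g : rel V) (A : {set V}) u v :
  (#|nb g A u| + #|nb g A v| <= #|A| + #|nb g A u :&: nb g A v|)%N.
Proof.
by rewrite -cardsUI leq_add2r subset_leq_card // subUset !nb_sub.
Qed.

(** The last hypothesis is the budget of [minor_of_linked_blocks]: the cost of making the blocks
    connected plus the average number of edges of [h] lost in the random assignment. [Q] is [m]
    minus the assumed lower bound for the degrees. *)
Lemma dense_graph_minor (R : realFieldType) (W V : finType) (h : rel W) (g : rel V)
    (A : {set V}) (P M s k q c n0 : nat) (B : R) :
  let m := #|A| in let t := #|W| in
  let Q : R := (200 * m%:R - 33 * P%:R) / 400 in
  irreflexive h -> symmetric g -> irreflexive g ->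
  (1 < t)%N -> (0 < s)%N -> (1 < M)%N -> (0 < k)%N -> (0 < q)%N -> 0 < B ->
  (m <= P)%N ->
  (forall u, u \in A -> (200 * m + 33 * P <= 400 * #|nb g A u|)%N) ->
  (200 * n0 <= 33 * m)%N ->
  (m * m * 50 * 2 ^ (2 * k) * 99 ^ n0 < 100 ^ n0)%N ->
  (m <= 50 * (q * k))%N -> (50 * (s * M) <= 49 * m)%N ->
  t%:R <= M%:R - 2 * M%:R / B ->
  t%:R * (2 * c%:R + s%:R * (1 - q%:R^-1) ^+ c) +
    (deg_sum h [set: W])%:R * (2 * M%:R ^+ 2 * (2 * B * (Q / (s * M)%:R) ^+ s) ^+ s)
      / (t * t.-1)%:R <= k%:R ->
  minor_in [set: W] h A g.
Proof.
move=> m t Q ih sg ig t1 s0 M1 k0 q0 B0 mP hdeg hn0 hres hmk hsM htM hfin.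
(* One set per pair of vertices, possibly equal; inclusion-exclusion gives it at least
   [33 * P / 200] elements. *)
pose C (i : 'I_#|A| * 'I_#|A|) := nb g A (enum_val i.1) :&: nb g A (enum_val i.2).
have hC u v : u \in A -> v \in A -> (n0 <= #|nb g A u :&: nb g A v|)%N.
  move=> uA vA; have := hdeg u uA; have := hdeg v vA; have := common_nb_card g A u v.
  rewrite -/m; lia.
have [||||R0 [R0A R0m hR0]] := @exists_reserve 50 (2 * k) n0 V _ A C.
- by [].
- by move=> i; apply: subset_trans (subsetIl _ _) (nb_sub _ _ _).
- by move=> i; apply: hC; apply: enum_valP.
- by rewrite card_prod !card_ord.
have hR u v : u \in A -> v \in A -> (2 * k <= #|R0 :&: (nb g A u :&: nb g A v)|)%N.
  move=> uA vA; have := hR0 (enum_rank_in uA u, enum_rank_in vA v).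
  by rewrite /C /= !enum_rankK_in.
(* The reserve takes at most [m / 50] vertices, so the grid of [s * M] positions fits outside it. *)
have [l [lI lA]] : exists l : 'I_s * 'I_M -> V, injective l /\ forall p, l p \in A :\: R0.
  apply: exists_inj_into; rewrite card_prod !card_ord cardsD (setIidPr R0A).
  rewrite -/m in R0m *; lia.
have lA' p : l p \in A by have := lA p; rewrite inE => /andP[].
pose na : rel ('I_s * 'I_M) := fun p' p => ~~ g (l p') (l p).
have m0 : (0 < m)%N by apply/card_gt0P; exists (l (Ordinal s0, Ordinal (ltnW M1))).
have hQ p : #|[set p' | na p' p]|%:R <= Q.
  have h1 : (#|[set p' | na p' p]| + #|nb g A (l p)| <= m)%N.
    rewrite -(card_imset _ lI) -cardsUI.
    have -> : l @: [set p' | na p' p] :&: nb g A (l p) = set0.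
      apply/setP => v; rewrite !inE; apply/negP => /andP[/imsetP[p' hp' ->] /andP[_]].
      by move: hp'; rewrite inE /na sg => /negbTE->.
    rewrite cards0 addn0 subset_leq_card // subUset nb_sub andbT.
    by apply/subsetP => v /imsetP[p' _ ->].
  have h2 := hdeg _ (lA' p).
  have h3 : (400 * #|[set p' | na p' p]| + 33 * P <= 200 * m)%N by lia.
  move: h3; rewrite /Q -(ler_nat R) natrD !natrM; clear; lra.
have Q0 : 0 < Q.
  have := hQ (Ordinal s0, Ordinal (ltnW M1)); apply: lt_le_trans.
  rewrite ltr0n; apply/card_gt0P; exists (Ordinal s0, Ordinal (ltnW M1)).
  by rewrite inE /na ig.
have [a [T [adis badT failT]]] := exists_good_blocks s0 M1 Q0 B0 hQ.
have TW : (#|W| <= #|T|)%N.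
  have := cardsC T; rewrite card_ord => hT.
  rewrite -(ler_nat R); apply: le_trans htM _.
  rewrite -[in X in X - _]hT natrD; lra.
have [th [thI thT hth]] := @exists_good_assignment R W _ h T
  (fun x y => (fails na (a x) (a y))%:R) _ _ ih t1 TW (fun x y => ler0n _ _) failT (deg_sumE R h).
pose S w := [set l (i, a (th w) i) | i : 'I_s].
pose E := [set p : W * W | h p.1 p.2 && fails na (a (th p.1)) (a (th p.2))].
have hE : #|E|%:R <= (deg_sum h [set: W])%:R * (2 * M%:R ^+ 2 * (2 * B * (Q / (s * M)%:R) ^+ s) ^+ s)
      / (t * t.-1)%:R :> R.
  have tt0 : (0 < t * t.-1)%N by move: t1; rewrite muln_gt0; clear; lia.
  rewrite ler_pdivlMr ?ltr0n //.
  apply: le_trans hth; rewrite mulrC ler_wpM2l //.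
  rewrite natr_card (eq_bigr (fun p => ((p.1, p.2) \in E)%:R)); last by case.
  rewrite -(pair_bigA _ (fun x y => ((x, y) \in E)%:R)) /=.
  apply: ler_sum => x _; rewrite [leRHS]big_mkcond; apply: ler_sum => y _.
  by rewrite inE /=; case: (h x y).
apply: (@minor_of_linked_blocks R W V h g A R0 S E s k q c) => //.
- by move: R0m hmk; rewrite -/m; clear; lia.
- move=> w; split.
  + by apply/subsetP => v /imsetP[i _ ->].
  + rewrite disjoints_subset; apply/subsetP => v /imsetP[i _ ->].
    by have := lA (i, a (th w) i); rewrite !inE => /andP[].
  + by rewrite card_imset ?card_ord // => i j /lI [].
- move=> x y xy; rewrite disjoints_subset; apply/subsetP => v /imsetP[i _ ->].
  rewrite inE; apply/negP => /imsetP[j _ /lI[ij]] /eqP; rewrite ij; apply/negP.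
  by apply: adis; rewrite (inj_eq thI).
- move=> x y hxy; rewrite inE /= hxy /= /fails negb_forall => /existsP[j].
  rewrite inE negb_forall => /existsP[i]; rewrite /na negbK => gij.
  by exists (l (i, a (th x) i)), (l (j, a (th y) j)); split=> //; apply: imset_f.
- by apply: le_trans hfin; rewrite lerD2l.
Qed.

(** * Numerical estimates *)

Lemma ln_le_subr1 (R : realType) (x : R) : 0 < x -> ln x <= x - 1.
Proof.
move=> x0; have := @le_ln1Dx R (x - 1).
by have -> : 1 + (x - 1) = x by [ring]; apply; lra.
Qed.

Lemma ln2_ge (R : realType) : 65 / 100 <= ln (2 : R).
Proof.
(* [(56 / 61) ^+ 8] is just above 1/2, and [8 * (5 / 61)] exceeds 65/100. *)
have z0 : 0 < 56 / 61 :> R by lra.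
have h1 : ln (2 : R)^-1 <= ln ((56 / 61 : R) ^+ 8).
  rewrite ler_ln ?posrE ?exprn_gt0 //; lra.
have h2 := ln_le_subr1 z0.
move: h1; rewrite lnXn // lnV ?posrE // -mulr_natl; lra.
Qed.

(* The bound [ln x <= x - 1] is used at [8 * r], which is of order 1 in the
   critical range of y = m/P, and at [2 * r] for large y. *)
Lemma exponent_ge (R : realType) (y r : R) : 0 < r -> 33 < 200 * y -> y <= 1 ->
  r <= (200 - 33 / y) / 384 -> 6 / 10 <= - ln r /\ 8 / 100 <= - ln r * y ^+ 2.
Proof.
move=> r0 y0 y1 hr.
have yp : 0 < y by lra.
have l2 := ln2_ge R.
have iy : y * y^-1 = 1 by rewrite divff // lt0r_neq0.
have iy0 : 0 < y^-1 by rewrite invr_gt0.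
have e8 : ln (8 * r) = 3 * ln 2 + ln r.
  rewrite lnM ?posrE //.
  have -> : (8 : R) = 2 ^+ 3 by rewrite !exprS expr0; lra.
  by rewrite lnXn // mulr_natl.
have a8 : ln (8 * r) <= 8 * r - 1 by apply: ln_le_subr1; lra.
have e2 : ln (2 * r) = ln 2 + ln r by rewrite lnM ?posrE.
have a2 : ln (2 * r) <= 2 * r - 1 by apply: ln_le_subr1; lra.
have b0 : 0 < 33 / y by apply: divr_gt0; lra.
have r2 : r <= 200 / 384 by lra.
have c6 : 6 / 10 <= - ln r by lra.
split=> //.
have [y4|y4] := leP (38 / 100) y.
  have : 144 / 10 / 100 <= y ^+ 2 by rewrite expr2; nra.
  nra.
(* Multiplied by [y ^+ 2], the lower bound becomes a concave quadratic in [y], which exceeds 8/100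
   at both ends 33/200 and 38/100 of the remaining range. *)
have hl : 295 / 100 - 8 * ((200 - 33 / y) / 384) <= - ln r by lra.
have y2 : 0 < y ^+ 2 by rewrite exprn_gt0.
have := ler_wpM2r (ltW y2) hl.
have -> : (295 / 100 - 8 * ((200 - 33 / y) / 384)) * y ^+ 2 =
   (295 / 100 - 1600 / 384) * y ^+ 2 + 264 / 384 * y.
  by field; rewrite lt0r_neq0.
move=> h; apply: le_trans h; rewrite expr2.
nra.
Qed.

(** In logarithms, with [la = - ln r], the claim reads [L ^+ 2 + S * ln 400 <= S ^+ 2 * la]. The
    term [L ^+ 2] takes 97 percent of the right side, the factors [2 * 200] the other 3 percent. *)
Lemma fail_probability_le (R : realType) (d L t M m P : R) (s : nat) :
  0 < d -> ln d = L ^+ 2 -> 50 * 10 * 10 * 10 <= L -> 0 < t -> 0 < m -> m <= P ->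
  33 * P < 200 * m -> 389 / 100 * L * t <= P -> M <= 103 / 100 * t ->
  96 / 100 * m <= s%:R * M ->
  d * (2 * 200 * (((200 * m - 33 * P) / 400) / (s%:R * M)) ^+ s) ^+ s <= 1.
Proof.
move=> d0 dL L0 t0 m0 mP Pm LP Mt sM.
have P0 : 0 < P by lra.
set S : R := s%:R in sM *.
have SM0 : 0 < S * M by lra.
have S0 : 0 < S.
  rewrite lt_def ler0n andbT; apply: contraTneq SM0 => ->.
  by rewrite mul0r ltxx.
set r := _ / (S * M).
have q0 : 0 < (200 * m - 33 * P) / 400 by lra.
have r0 : 0 < r := divr_gt0 q0 SM0.
pose y := m / P.
have my : m = y * P by rewrite /y divfK // lt0r_neq0.
have y0 : 33 < 200 * y.
  by rewrite -(ltr_pM2r P0) -mulrA -my.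
have y1 : y <= 1 by rewrite /y ler_pdivrMr // mul1r.
have yp : 0 < y by lra.
clearbody y.
(* 384 is 400 * 96/100, the second factor coming from [sM]. *)
have hr : r <= (200 - 33 / y) / 384.
  rewrite /r ler_pdivrMr //.
  have c0 : 0 <= (200 - 33 / y) / 384.
    have : 33 / y <= 200 by rewrite (ler_pdivrMr _ _ yp); lra.
    lra.
  apply: le_trans (ler_wpM2l c0 sM).
  rewrite my le_eqVlt; apply/orP; left; apply/eqP; field.
  by rewrite lt0r_neq0.
clearbody r.
have [l1 l2] := exponent_ge r0 y0 y1 hr.
set la := - ln r in l1 l2.
(* [96 / 103 * (389 / 100)] exceeds 36/10. *)
have hS : 36 / 10 * y * L <= S.
  have h1 : 96 / 100 * (y * P) <= S * (103 / 100 * t).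
    rewrite -my; apply: le_trans sM _; exact: ler_wpM2l (ltW S0) _ _ Mt.
  have h2 : 96 / 100 * y * (389 / 100 * L * t) <= 96 / 100 * y * P.
    by apply: ler_wpM2l LP; lra.
  rewrite -(ler_pM2r t0).
  have h3 : 0 < y * L * t by rewrite !mulr_gt0 //; lra.
  lra.
(* The constants just suffice: [(36 / 10) ^+ 2 * (8 / 100)] is 1.0368, and 97 percent of it still
   exceeds 1. *)
have hS2 : L ^+ 2 <= 97 / 100 * (S ^+ 2 * la).
  have h1 : (36 / 10 * y * L) ^+ 2 <= S ^+ 2.
    apply: lerXn2r hS; rewrite nnegrE; last exact: ltW.
    by apply: mulr_ge0; [apply: mulr_ge0; last exact: ltW|]; clear -L0; lra.
  have la0 : 0 <= la by lra.
  have h2 := ler_wpM2r la0 h1.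
  have L2 : 0 < L ^+ 2 by rewrite exprn_gt0 //; lra.
  have h3 := ler_wpM2r (ltW L2) l2.
  have e : (36 / 10 * y * L) ^+ 2 * la = (36 / 10) ^+ 2 * (la * y ^+ 2 * L ^+ 2) by ring.
  rewrite e in h2.
  have : 8 / 100 * L ^+ 2 * (36 / 10) ^+ 2 <= S ^+ 2 * la.
    apply: le_trans h2; rewrite mulrC; apply: ler_wpM2l h3.
    by rewrite exprn_ge0 //; lra.
  rewrite [(36 / 10) ^+ 2]expr2; lra.
have hS3 : 399 <= 3 / 100 * (S * la).
  have h1 : 25 * 10 * 10 * 10 <= S by apply: le_trans hS; nra.
  have h2 := ler_wpM2l (ltW S0) l1.
  lra.
have X0 : 0 < 2 * 200 * r ^+ s by rewrite !mulr_gt0 // exprn_gt0.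
rewrite -(@ler_ln R) ?posrE ?mulr_gt0 ?exprn_gt0 // ln1.
rewrite lnM ?posrE ?exprn_gt0 // lnXn // lnM ?posrE ?exprn_gt0 //.
rewrite lnXn // dL -[_ *+ s in X in _ + X]mulr_natl -[ln r *+ s]mulr_natl -/S.
have h4 : ln (2 * 200 : R) <= 399.
  by apply: le_trans (ln_le_subr1 _) _; lra.
rewrite -[ln r]opprK -/la.
have h5 : S * (ln (2 * 200 : R)) <= 3 / 100 * (S * (S * la)) by nra.
rewrite mulrDr mulrN mulrN.
have e : S ^+ 2 * la = S * (S * la) by ring.
rewrite e in hS2; lra.
Qed.

Lemma sqr_lt_exp2 (e : nat) : (12 <= e)%N -> ((e + 30) ^ 2 < 2 ^ e)%N.
Proof.
elim: e => // e IH; rewrite leq_eqVlt => /orP[/eqP<- //|h].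
have {IH} := IH h; rewrite [(2 ^ e.+1)%N]expnS -!mulnn; nia.
Qed.

Lemma bernoulli_nat (a n : nat) : (a ^ n.+1 + n.+1 * a ^ n <= (a + 1) ^ n.+1)%N.
Proof.
elim: n => [|n IH]; first by rewrite !expn1 expn0; lia.
rewrite [((a + 1) ^ n.+2)%N]expnS; apply: leq_trans (leq_mul (leqnn (a + 1)) IH).
rewrite !expnS; set y := (a ^ n)%N.
by rewrite mulnDr !mulnDl !mul1n mulSn !mulnA; lia.
Qed.

Lemma double_expn_le (a : nat) : (0 < a)%N -> (2 * a ^ a <= (a + 1) ^ a)%N.
Proof.
case: a => // n _; apply: leq_trans (bernoulli_nat n.+1 n).
by rewrite -expnS mul2n -addnn.
Qed.

(** By Bernoulli [(1 + 1 / a) ^ a] is at least 2, so every [a] factors of the ratio gain a factor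
    2. *)
Lemma expn_ratio_lt (a j n x : nat) : (0 < a)%N -> (a * j <= n)%N ->
  (x < 2 ^ j)%N -> (x * a ^ n < (a + 1) ^ n)%N.
Proof.
move=> a0 /subnKC<- hx; set e := (n - _)%N; rewrite !expnD.
have h1 : (2 ^ j * a ^ (a * j) <= (a + 1) ^ (a * j))%N.
  rewrite !expnM -expnMn; case: (j) => // i.
  by rewrite leq_exp2r // double_expn_le.
have h2 : (a ^ e <= (a + 1) ^ e)%N.
  by case: (e) => // i; rewrite leq_exp2r // addn1.
rewrite mulnA; apply: leq_trans (leq_mul h1 h2).
by rewrite ltn_pmul2r ?expn_gt0 ?a0 // ltn_pmul2r ?expn_gt0 ?a0.
Qed.

Lemma reserve_bound (m : nat) : (601 * 1000 <= m)%N ->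
  (m * m * 50 * 2 ^ (2 * (m %/ 2400)) * 99 ^ (33 * m %/ 200) < 100 ^ (33 * m %/ 200))%N.
Proof.
move=> hm; set k := (m %/ 2400)%N; set n0 := (33 * m %/ 200)%N.
(* [99 * j <= n0] is needed, and 99/600 = 33/200; 601 leaves room for rounding. *)
pose j := (m %/ 601)%N.
apply: (@expn_ratio_lt 99 j n0) => //; first by rewrite /j /n0; lia.
(* 28 = 11 + 11 + 6: each factor [m] is at most [2 ^ 11 * (e + 30)], 50 is below [2 ^ 6], and
   [2 ^ e] absorbs [(e + 30) ^ 2]. *)
have [e he] : exists e, (j = 2 * k + (28 + e))%N.
  by exists (j - 2 * k - 28)%N; rewrite /j /k; lia.
have e12 : (12 <= e)%N by rewrite /j /k in he; lia.
have me : (m <= 2048 * (e + 30))%N by rewrite /j /k in he; lia.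
rewrite he expnD mulnC ltn_pmul2l ?expn_gt0 //.
have -> : (28 + e = 11 + 11 + (6 + e))%N by lia.
have := sqr_lt_exp2 e12; rewrite !expnD.
have -> : (2 ^ 11 = 2048)%N by [].
have -> : (2 ^ 6 = 64)%N by [].
set X := (2 ^ e)%N; move=> hX.
have := leq_mul me me; nia.
Qed.

Lemma half_expn (R : realFieldType) (a : nat) : (0 < a)%N ->
  (1 - (a.+1)%:R^-1) ^+ a <= 2^-1 :> R.
Proof.
move=> a0; have -> : 1 - (a.+1)%:R^-1 = a%:R / a.+1%:R :> R.
  by rewrite -[in RHS](addrK 1 a%:R) natr1 mulrBl divff ?pnatr_eq0 // mul1r.
rewrite expr_div_n ler_pdivrMr ?exprn_gt0 ?ltr0n //.
rewrite mulrC ler_pdivlMr // -!natrX -natrM ler_nat mulnC -(addn1 a).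
exact: double_expn_le.
Qed.

Lemma many_vertices (t : nat) : (100 <= t)%N ->
  (601 * 1000 <= 24 * 100 * (40 * 100 * (2 * t)))%N.
Proof. by move=> t100; lia. Qed.

(** [M] exceeds [t] by 2 to 3 percent, which allows blocks to be discarded; [s] is the largest
    number of layers that fits in 49/50 of the vertices; 2400 is below 50 * 49 to leave room for
    rounding [k]. *)
Lemma block_parameters (m t : nat) : (100 <= t)%N ->
  (24 * 100 * (40 * 100 * (2 * t)) <= m)%N ->
  let M := (t + t %/ 50 + 1)%N in let s := (49 * m %/ (50 * M))%N in
  let k := (m %/ 2400)%N in
  [/\ (1 < M)%N, (0 < s)%N, (50 * (s * M) <= 49 * m)%N &
   [/\ (100 * M <= 103 * t)%N, (102 * t <= 100 * M)%N, (96 * m <= 100 * (s * M))%N &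
   [/\ (80 * 100 * t <= k)%N, (m <= 50 * (49 * k))%N & (t * s <= m)%N]]].
Proof.
move=> t100 tm M s k.
have M1 : (1 < M)%N by rewrite /M; lia.
have Mt : (100 * M <= 103 * t)%N by rewrite /M; lia.
have tM : (102 * t <= 100 * M)%N by rewrite /M; lia.
have sM1 : (50 * (s * M) <= 49 * m)%N by rewrite mulnCA leq_trunc_div.
have sM2 : (96 * m <= 100 * (s * M))%N.
  have M50 : (0 < 50 * M)%N by lia.
  have := ltn_ceil (49 * m) M50; rewrite -/s mulSn; nia.
have s0 : (0 < s)%N by rewrite lt0n; apply: contraTneq sM2 => ->; lia.
have k0 : (80 * 100 * t <= k)%N by rewrite /k; lia.
have mk : (m <= 50 * (49 * k))%N by rewrite /k; lia.
have ts : (t * s <= m)%N by nia.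
by [].
Qed.

Lemma ler_natr_scale (R : realFieldType) (a b x y : nat) : (0 < a)%N ->
  (a * x <= b * y)%N -> x%:R <= b%:R / a%:R * y%:R :> R.
Proof.
move=> a0 h; rewrite mulrAC ler_pdivlMr ?ltr0n // -!natrM ler_nat mulnC.
exact: h.
Qed.

(** [pr] stands for the failure probability and [pw] for the fraction of a block left after the
    rounds of [connect_through]. The rounds cost [1344 * t], the leftovers at most [16 / 100 * k],
    the lost edges at most [5 * t]. *)
Lemma linking_cost_le (R : realFieldType) (t s m k M d pr pw : R) :
  100 <= t -> 0 <= s -> t * s <= m -> m <= 50 * (49 * k) -> 80 * 100 * t <= k ->
  0 <= M -> M <= 103 / 100 * t -> 0 <= pr -> d * pr <= 1 ->
  0 <= pw -> pw <= 2^-1 ^+ 14 ->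
  t * (2 * (48 * 14) + s * pw) + d * t * (2 * M ^+ 2 * pr) / (t * (t - 1)) <= k.
Proof.
move=> t100 s0 tsm mk tk M0 Mt pr0 dpr pw0 hpw.
have t0 : 0 < t by clear -t100; lra.
have k0 : 0 <= k by clear -t0 tk; lra.
have hpw' : pw <= 1 / 16 / 32 / 32.
  by apply: le_trans hpw _; rewrite !exprS expr0; clear; lra.
have h1 : t * (s * pw) <= 16 / 100 * k.
  rewrite mulrA; apply: le_trans (_ : _ <= m * (1 / 16 / 32 / 32)) _.
    by apply: ler_pM => //; apply: mulr_ge0 => //; apply: ltW.
  by clear -mk k0; lra.
have h2 : d * t * (2 * M ^+ 2 * pr) / (t * (t - 1)) <= 5 * t.
  have t1 : 99 / 100 * t <= t - 1 by clear -t100; lra.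
  have t10 : 0 < t - 1 by clear -t100; lra.
  rewrite ler_pdivrMr; last exact: mulr_gt0.
  have M2 : M ^+ 2 <= (103 / 100 * t) ^+ 2.
    by apply: lerXn2r; rewrite // nnegrE; apply: le_trans Mt.
  have -> : d * t * (2 * M ^+ 2 * pr) = (d * pr) * (2 * t * M ^+ 2) by ring.
  apply: le_trans (_ : _ <= 2 * t * M ^+ 2) _.
    by apply: ler_piMl => //; apply: mulr_ge0; [clear -t0; lra|exact: exprn_ge0].
  have t20 : 0 <= 2 * t by clear -t0; lra.
  apply: le_trans (ler_wpM2l t20 M2) _.
  have tt : 0 <= t * t by apply: mulr_ge0; apply: ltW.
  have h3 := ler_wpM2l tt t1; have h4 := mulr_ge0 tt (ltW t0).
  rewrite expr2; clear -h3 h4; lra.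
rewrite mulrDr; clear -h1 h2 tk t0; lra.
Qed.

(** * Choice of the parameters *)

Lemma large_dense_graph_minor (R : realType) (W V : finType) (h : rel W) (g : rel V)
    (A : {set V}) (P : nat) (d L : R) :
  irreflexive h -> symmetric g -> irreflexive g ->
  0 < d -> ln d = L ^+ 2 -> 50 * 100 * 100 * 100 <= L -> (100 <= #|W|)%N ->
  (deg_sum h [set: W])%:R = d * #|W|%:R ->
  (0 < #|A| <= P)%N ->
  (forall u, u \in A -> (200 * #|A| + 33 * P <= 400 * #|nb g A u|)%N) ->
  389 / 100 * L * #|W|%:R <= P%:R ->
  minor_in [set: W] h A g.
Proof.
move=> ih sg ig d0 dL L0 t100 hD /andP[m0 mP] hdeg hP.
set m := #|A| in m0 mP hdeg *; set t := #|W| in t100 hD hP *.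
(* A vertex has fewer than [m] neighbours in [A], so the degree condition bounds [m] below in terms
   of [P]. *)
have Pm : (33 * P < 200 * m)%N.
  case/card_gt0P: (m0) => u uA; have := hdeg u uA.
  have : (#|nb g A u| < m)%N.
    rewrite /m (cardsD1 u A) uA add1n ltnS; apply: subset_leq_card.
    apply/subsetP => v; rewrite !inE => /andP[-> guv]; rewrite andbT.
    by apply: contraTneq guv => ->; rewrite ig.
  lia.
have tR : 100 <= t%:R :> R by rewrite (ler_nat R 100).
have PmR : 33 * P%:R < 200 * m%:R :> R by rewrite -!natrM ltr_nat.
have t0 : 0 < t%:R :> R by rewrite ltr0n; apply: leq_trans t100.
have L1 : 50 * 10 * 10 * 10 <= L by clear -L0; lra.
have tm : (24 * 100 * (40 * 100 * (2 * t)) <= m)%N.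
  rewrite -(ler_nat R) !natrM.
  have : 50 * 100 * 100 * 100 * t%:R <= L * t%:R by rewrite ler_wpM2r.
  lra.
have m601 := leq_trans (many_vertices t100) tm.
have [] := block_parameters t100 tm.
set M := (t + _ + 1)%N; set s := (_ %/ (50 * M))%N; set k := (m %/ 2400)%N.
move=> M1 s0 sM1 [Mt tM sM2 [k0 mk ts]].
have MtR : M%:R <= 103 / 100 * t%:R :> R by apply: ler_natr_scale.
have tMR : t%:R <= 100 / 102 * M%:R :> R by apply: ler_natr_scale.
have sMR : 96 / 100 * m%:R <= s%:R * M%:R :> R.
  rewrite -natrM mulrAC ler_pdivrMr ?ltr0n // -!natrM ler_nat mulnC.
  by rewrite [leqRHS]mulnC mulnC.
have m0R : 0 < m%:R :> R by rewrite ltr0n.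
have mPR : m%:R <= P%:R :> R by rewrite ler_nat.
have tsR : t%:R * s%:R <= m%:R :> R by rewrite -natrM ler_nat.
have mkR : m%:R <= 50 * (49 * k%:R) :> R by rewrite -!natrM ler_nat.
have tkR : 80 * 100 * t%:R <= k%:R :> R by rewrite -!natrM ler_nat.
have t1 : (1 < t)%N by apply: leq_trans t100.
have k1 : (0 < k)%N by apply: leq_trans k0; rewrite !muln_gt0 /=; apply: leq_trans t1.
have B0 : 0 < 200 :> R by rewrite ltr0n.
have hn0 : (200 * (33 * m %/ 200) <= 33 * m)%N by rewrite mulnC leq_trunc_div.
have hres := reserve_bound m601.
have htM : t%:R <= M%:R - 2 * M%:R / 200 :> R.
  by move: tMR (ler0n R M); clear; lra.
(* [B = 200] discards at most [M / 100] blocks, [q = 49] matches [m <= 50 * (49 * k)], and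
   [c = 48 * 14] brings the power of 48/49 below that of 1/2 with exponent 14. *)
apply: (@dense_graph_minor R W V h g A P M s k 49 (48 * 14) _ 200
  ih sg ig t1 s0 M1 k1 isT B0 mP hdeg hn0 hres mk sM1 htM).
rewrite -/m -/t.
have fp := @fail_probability_le R d L t%:R M%:R m%:R P%:R s d0 dL L1 t0 m0R mPR PmR hP MtR sMR.
have t1E : t.-1%:R = t%:R - 1 :> R by rewrite -subn1 natrB // ltnW.
rewrite hD [(s * M)%:R]natrM [(t * t.-1)%:R]natrM [(48 * 14)%:R]natrM t1E.
have q1 : 0 <= 1 - 49%:R^-1 :> R by rewrite subr_ge0 invf_le1 ?ltr0n // ler1n.
apply: (linking_cost_le tR (ler0n R s) tsR mkR tkR (ler0n R M) MtR _ fp).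
- apply: exprn_ge0; apply: mulr_ge0; first exact: mulr_ge0.
  apply: exprn_ge0; apply: divr_ge0; last exact: mulr_ge0.
  by move: PmR; clear; lra.
- exact: exprn_ge0.
- rewrite exprM; apply: lerXn2r; rewrite ?nnegrE ?exprn_ge0 //.
  exact: half_expn.
Qed.

(** * From average degrees to the theorem *)

Lemma avg_degE (R : realType) (V : finType) (g : rel V) :
  avg_deg R g = (deg_sum g [set: V])%:R / #|V|%:R.
Proof.
rewrite /avg_deg /deg_sum; congr (_%:R / _).
apply: eq_big => [v|v _]; first by rewrite in_setT.
by apply: eq_card => u; rewrite !inE.
Qed.

Lemma deg_sum_le (V : finType) (g : rel V) : (deg_sum g [set: V] <= #|V| * #|V|)%N.
Proof.
rewrite -[X in (_ <= X * _)%N]cardsT -sum_nat_const.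
by apply: leq_sum => v _; apply: max_card.
Qed.

(** The bound [v] is rounded down to a natural number for [dense_minor]; the gap between 3.895 and
    3.89 pays for this. *)
Lemma sparse_minor (R : realType) (K : R) (W V : finType) (h : rel W) (g : rel V) :
  50 * 100 * 100 * 100 <= K -> simple_graph h -> simple_graph g ->
  expR (K ^+ 2) <= avg_deg R h ->
  3895 / 1000 * Num.sqrt (ln (avg_deg R h)) * #|W|%:R <= avg_deg R g ->
  is_minor h g.
Proof.
move=> hK [sh ih] [sg ig].
have K100 : 100 <= K by clear -hK; lra.
set d := avg_deg R h => hd; set L := Num.sqrt (ln d) => hv.
have d0 : 0 < d by apply: lt_le_trans hd; apply: expR_gt0.
have K2 : K ^+ 2 <= ln d by rewrite -[leLHS]expRK ler_ln ?posrE ?expR_gt0.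
have dL : ln d = L ^+ 2 by rewrite sqr_sqrtr // (le_trans _ K2) // sqr_ge0.
have KL : K <= L.
  have := ler_wsqrtr K2; rewrite sqrtr_sqr ger0_norm //.
  exact: le_trans K100.
have t0 : (0 < #|W|)%N.
  rewrite lt0n; apply: contraTneq d0 => t0.
  by rewrite /d avg_degE t0 invr0 mulr0 ltxx.
have tR : 0 < #|W|%:R :> R by rewrite ltr0n.
have hD : (deg_sum h [set: W])%:R = d * #|W|%:R.
  by rewrite /d avg_degE divfK // lt0r_neq0.
(* The average degree is at most the number of vertices, so a large [d] forces [H] to have many
   vertices. *)
have dt : d <= #|W|%:R.
  rewrite -(ler_pM2r tR) -hD -natrM ler_nat; exact: deg_sum_le.
have t100 : (100 <= #|W|)%N.
  rewrite -(ler_nat R); apply: le_trans (le_trans hd dt).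
  apply: le_trans (expR_ge1Dx _).
  have : 100 * 100 <= K ^+ 2 by rewrite expr2; apply: (ler_pM _ _ K100 K100); clear; lra.
  clear; lra.
set v := 3895 / 1000 * L * _ in hv.
have L0 : 0 <= L by apply: le_trans KL; apply: le_trans K100.
have v0 : 0 <= v.
  apply: mulr_ge0; last exact: ler0n.
  by apply: (mulr_ge0 _ L0); apply: divr_ge0; apply: ler0n.
have Lt : 100 * 100 * 10 <= L * #|W|%:R.
  apply: (@le_trans _ _ (K * 100)); first by clear -hK; lra.
  apply: ler_pM => //; first exact: le_trans K100.
  by rewrite (ler_nat R 100).
have /andP[P0v vP0] := truncn_itv v0; set P0 := Num.truncn v in P0v vP0.
have vE : 389 / 100 * L * #|W|%:R + 5 / 1000 * (L * #|W|%:R) = v.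
  by rewrite /v; field.
have hP0 : 389 / 100 * L * #|W|%:R <= P0%:R.
  move: vP0 vE Lt; rewrite -natr1; clear; lra.
have P1100 : (1100 <= P0)%N.
  rewrite -(ler_nat R); apply: le_trans hP0.
  rewrite -mulrA; move: Lt; clear; lra.
(* The empty graph has average degree 0 by the convention on division, which is below [v]. *)
have V0 : (0 < #|V|)%N.
  rewrite lt0n; apply/negP => /eqP V0.
  move: hv; rewrite avg_degE V0 invr0 mulr0 => hv.
  move: hv P0v P1100; rewrite -(ler_nat R); clear; lra.
have hDg : (P0 * #|V| <= deg_sum g [set: V])%N.
  rewrite -(ler_nat R) natrM -ler_pdivlMr ?ltr0n // -avg_degE.
  exact: le_trans hv.
have [P [A [g1 [hP sg1 ig1 mg1 [cA dA]]]]] := dense_minor sg ig V0 P1100 hDg.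
apply: minor_in_is_minor; apply: minor_in_trans mg1.
apply: (@large_dense_graph_minor R W V h g1 A P d L ih sg1 ig1 d0 dL _ t100 hD cA dA).
  exact: le_trans KL.
by apply: le_trans hP0 _; rewrite ler_nat.
Qed.

Local Close Scope ring_scope.

Theorem theorem1 (R : realType) :
  exists d0 : R, forall (W : finType) (h : rel W),
    simple_graph h -> (d0 <= avg_deg R h)%R ->
    (fH R h <= ((3895%:R / 1000%:R) * Num.sqrt (ln (avg_deg R h)) * #|W|%:R)%:E)%E.
Proof.
(* The square root of [ln d] is then at least [50 * 100 * 100 * 100], so that all lower-order terms
   and rounding errors are absorbed. *)
exists (expR ((50 * 100 * 100 * 100) ^+ 2))%R => W h sh hd.
apply: ereal_inf_lbound; exists (3895 / 1000 * Num.sqrt (ln (avg_deg R h)) * #|W|%:R)%R => //=.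
by move=> V g sg hv; apply: (sparse_minor (lexx _) sh sg hd hv).
Qed.
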